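(* Let $e,m,n$ be integers with $1\le m<n\le e-2$. The semigroup ring $\mathbb K[S(e,m,n)]$ is Gorenstein if and only if $(m,n)=(2,3)$ or $(e,m,n)=(4,1,2)$.
   Context: $\mathbb K$ is an algebraically closed field of characteristic zero. For $1\le m<n\le e-2$, $S(e,m,n)$ is the numerical semigroup generated by $\{e,e+1,\ldots,2e-1\}\setminus\{e+m,e+n\}$, and $\mathbb K[S(e,m,n)]=\mathbb K[t^s\mid s\in S(e,m,n)]\subseteq\mathbb K[t]$ is its semigroup ring. *)

(* Defs.v *)
From HB Require Import structures.
From mathcomp Require Import all_boot all_order all_algebra.
From mathcomp Require Import boolp.

Set Implicit Arguments.
Unset Strict Implicit.
Unset Printing Implicit Defensive.

Import GRing.Theory.
Local Open Scope ring_scope.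

Section InjectiveDimension.
Variable R : comNzRingType.

Definition injective_module (E : lmodType R) : Prop :=
  forall (M N : lmodType R) (i : {linear M -> N}) (f : {linear M -> E}),
    injective i -> exists g : {linear N -> E}, forall x, g (i x) = f x.

(* There is an injective resolution
   0 -> M -> E 0 -> E 1 -> ... -> E n -> 0. *)
Definition injdim_le (M : lmodType R) (n : nat) : Prop :=
  exists (E : nat -> lmodType R) (eps : {linear M -> E 0%N})
         (d : forall i, {linear E i -> E i.+1}),
    [/\ forall i, injective_module (E i),
        injective eps,
        forall x, d 0%N x = 0 <-> exists y, eps y = x,
        forall i x, d i.+1 x = 0 <-> exists y, d i y = x
      & forall i, (n < i)%N -> forall x : E i, x = 0].

Definition finite_injdim (M : lmodType R) : Prop := exists n, injdim_le M n.

End InjectiveDimension.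

Section Gorenstein.
Variable R : comNzRingType.

(* [idealr_closed] describes the proper ideals; nothing is lost here since
   the unit ideal is generated by 1. *)
Definition noetherian : Prop :=
  forall I : {pred R}, idealr_closed I ->
    exists2 s : seq R, {subset s <= I}
      & forall x, x \in I -> exists c : R -> R, x = \sum_(g <- s) c g * g.

Definition maximal_ideal (P : {pred R}) : Prop :=
  idealr_closed P /\
  forall J : {pred R}, idealr_closed J -> {subset P <= J} -> {subset J <= P}.

(* For P a prime ideal, phi : R -> A exhibits A as the localization R_P; this
   determines A up to a unique isomorphism of R-algebras. *)
Definition is_localization_at (P : {pred R}) (A : comNzRingType)
    (phi : {rmorphism R -> A}) : Prop :=
  [/\ forall s, s \notin P -> exists b, phi s * b = 1,
      forall a, exists r, exists2 s, s \notin P & a * phi s = phi r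
    & forall r, phi r = 0 -> exists2 s, s \notin P & s * r = 0].

(* A Noetherian ring is Gorenstein if its localizations at maximal ideals have
   finite injective dimension over themselves. *)
Definition gorenstein : Prop :=
  noetherian /\
  forall P : {pred R}, maximal_ideal P ->
    exists (A : comNzRingType) (phi : {rmorphism R -> A}),
      is_localization_at P phi /\ finite_injdim (A^o : lmodType A).

End Gorenstein.

Arguments gorenstein R : clear implicits.

Definition semigroup_gen (G : {pred nat}) : {pred nat} :=
  [pred x | `[< exists2 s : seq nat, {subset s <= G} & x = sumn s >]].

Lemma semigroup_gen0 (G : {pred nat}) : 0%N \in semigroup_gen G.
Proof. by apply/asboolP; exists [::]. Qed.

Lemma semigroup_genD (G : {pred nat}) :
  {in semigroup_gen G &, forall x y, (x + y)%N \in semigroup_gen G}.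
Proof.
move=> _ _ /asboolP[s sG ->] /asboolP[t tG ->]; apply/asboolP.
exists (s ++ t); last by rewrite sumn_cat.
by move=> z; rewrite mem_cat => /orP[/sG|/tG].
Qed.

Section SemigroupRing.
Variables (K : fieldType) (G : {pred nat}).

(* The polynomials that are K-linear combinations of the powers 'X^s, where s
   lies in the semigroup generated by G. *)
Definition semigroup_poly : {pred {poly K}} :=
  [pred p : {poly K} | `[< forall i, p`_i != 0 -> i \in semigroup_gen G >]].

Lemma semigroup_polyP (p : {poly K}) :
  reflect (forall i, p`_i != 0 -> i \in semigroup_gen G)
          (p \in semigroup_poly).
Proof. exact: asboolP. Qed.

Lemma semigroup_poly_subring : subring_closed semigroup_poly.
Proof.
split=> [|p q /semigroup_polyP pS /semigroup_polyP qS
         |p q /semigroup_polyP pS /semigroup_polyP qS]; apply/semigroup_polyP.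
- by move=> i; rewrite coef1; case: i => [|i]; rewrite ?eqxx // semigroup_gen0.
- move=> i; rewrite coefB; have [->|/pS //] := eqVneq p`_i 0.
  by rewrite sub0r oppr_eq0 => /qS.
move=> i; apply: contraR => iS; rewrite coefM big1 // => j _.
have [->|/pS jS] := eqVneq p`_j 0; first by rewrite mul0r.
have [->|/qS kS] := eqVneq q`_(i - j) 0; first by rewrite mulr0.
by case/negP: iS; rewrite -(subnKC (ltn_ord j : j <= i)%N) semigroup_genD.
Qed.

HB.instance Definition _ :=
  GRing.isSubringClosed.Build {poly K} semigroup_poly semigroup_poly_subring.

Record semigroup_ring := SemigroupRing {
  semigroup_ring_val :> {poly K};
  _ : semigroup_ring_val \in semigroup_poly
}.

HB.instance Definition _ := [isSub for semigroup_ring_val].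
HB.instance Definition _ := [Choice of semigroup_ring by <:].
HB.instance Definition _ :=
  [SubChoice_isSubComNzRing of semigroup_ring by <:].

End SemigroupRing.

(* Generators of the numerical semigroup S(e, m, n). *)
Definition Sally_gens (e m n : nat) : {pred nat} :=
  [pred k | (e <= k <= 2 * e - 1)%N && (k \notin [:: e + m; e + n]%N)].

(* Main.v *)
Require Import Defs.
From HB Require Import structures.
From mathcomp Require Import all_boot all_order all_algebra.
From mathcomp Require Import ring zify.
From mathcomp Require Import boolp classical_sets.

Set Implicit Arguments.
Unset Strict Implicit.
Unset Printing Implicit Defensive.

Import GRing.Theory.
Local Open Scope ring_scope.

(** Write S for S(e,m,n) and R for its semigroup ring K[S].  The ring R is
Gorenstein exactly when S is symmetric, that is, when i |-> Fr - i exchanges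
S with its complement in the integers, Fr being the largest gap of S.  Both
implications are proved with modules over a localization A of R at a maximal
ideal P, using Baer's criterion: a module E is injective as soon as every
linear map from an ideal of A to E is of the form a |-> a e.

Suppose S is symmetric.  The resolution of A is 0 -> A -> F -> F/A -> 0 with
F = K(t) (injdim_le1).  The field F is injective, and it remains to extend
linear maps from an ideal J to F/A.
- If P does not contain t^e, then t lies in A, so that A is a localization of
  K[t]; every ideal J is principal and F/A is divisible
  (regular_point_extension).
- Otherwise P is the ideal of the origin.  A nonzero ideal J contains some
  x = t^N, and after subtracting the map a |-> a (f(x) / x) from f, the map
  x f sends J to A and x to 0, modulo x A.  By symmetry, an element of A/xA
  is determined by the coefficients of t^(Fr+N) in its multiples.  The
  K-linear functional coef_(Fr+N) (x f) on J extends to a functional mu on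
  K[t], and q = sum_s mu(t^s) t^(Fr+N-s) represents x f
  (origin_extension).
That R is noetherian follows by comparing degrees modulo e: finitely many
elements of minimal degree generate an ideal.

Conversely let A be the localization at the origin, and suppose that A has a
finite injective resolution E.  Let x be a regular nonunit.  Descending along
the resolution, the cosyzygies ker (d : E i -> E (i+1)) with i >= 1 satisfy
Baer's condition at every ideal containing x: one first extends maps from the
maximal ideal m, lifting socle elements through E i with the help of an element
s that represents a socle element of A/xA, and then passes to the other ideals
by enlarging the domain one element at a time.  At i = 1 this forces the socle
of A/xA to be generated by s (finite_injdim_socle).  With x = t^e, the
elements t^(F1+e) and t^(F2+e) represent independent socle elements whenever
F1 and F2 are two distinct pseudo-Frobenius numbers of S, that is gaps that
enter S when any positive element of S is added to them
(gorenstein_pseudo_frobenius).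

What is left is the semigroup itself.  For (m,n) = (2,3) it is symmetric with
largest gap 2e+3, and S(4,1,2) is generated by 4 and 7 and is symmetric with
largest gap 17.  Otherwise there are two pseudo-Frobenius numbers: e+m and e+n
if m >= 2, e+n and 2e+1 if m = 1 and n >= 4, 2e+1 and 2e+n if m = 1 and n is 2
or 3. *)

(** * Extension of linear maps and Baer's criterion *)

Section ModuleExtension.
Variable A : comNzRingType.

Definition submodule (V : lmodType A) (D : V -> Prop) : Prop :=
  D 0 /\ forall a u v, D u -> D v -> D (a *: u + v).

Definition linear_on (V W : lmodType A) (D : V -> Prop) (f : V -> W) : Prop :=
  forall a u v, D u -> D v -> f (a *: u + v) = a *: f u + f v.

Lemma submoduleZ (V : lmodType A) (D : V -> Prop) a u :
  submodule D -> D u -> D (a *: u).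
Proof. by case=> D0 DD Du; rewrite -[_ *: _]addr0; apply: DD. Qed.

Lemma submoduleD (V : lmodType A) (D : V -> Prop) u v :
  submodule D -> D u -> D v -> D (u + v).
Proof. by case=> D0 DD Du Dv; rewrite -[u]scale1r; apply: DD. Qed.

Lemma submoduleB (V : lmodType A) (D : V -> Prop) u v :
  submodule D -> D u -> D v -> D (u - v).
Proof. by case=> D0 DD Du Dv; rewrite addrC -scaleN1r; apply: DD. Qed.

Lemma linear_on0 (V W : lmodType A) (D : V -> Prop) (f : V -> W) :
  submodule D -> linear_on D f -> f 0 = 0.
Proof.
case=> D0 _ fL; have := fL 1 0 0 D0 D0; rewrite scaler0 addr0 scale1r => h.
by apply: (@addrI _ (f 0)); rewrite addr0 -h.
Qed.

Lemma linear_onZ (V W : lmodType A) (D : V -> Prop) (f : V -> W) a u :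
  submodule D -> linear_on D f -> D u -> f (a *: u) = a *: f u.
Proof.
move=> DS fL Du; rewrite -[a *: u]addr0 fL ?(linear_on0 DS fL) ?addr0 //.
by case: DS.
Qed.

(** A partial linear map is handled through its graph: the good graphs are
ordered by inclusion, and a maximal one is total.  The set Z confines the values
to a submodule, so that the lemma also extends maps into a kernel. *)
Section Extend.
Variables (N E : lmodType A) (D : N -> Prop) (f : N -> E) (Z : E -> Prop).
Hypotheses (DS : submodule D) (fL : linear_on D f) (ZS : submodule Z).
Hypothesis fZ : forall u, D u -> Z (f u).

Let good (G : N * E -> Prop) : Prop :=
  [/\ submodule (G : (N * E)%type -> Prop), forall v, G (0, v) -> v = 0,
      forall u v, G (u, v) -> Z v & forall u, D u -> G (u, f u)].

Let good_functional G u v w : good G -> G (u, v) -> G (u, w) -> v = w.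
Proof.
case=> GS G0 _ _ Gv Gw; apply/eqP; rewrite -subr_eq0; apply/eqP/G0.
suff -> : (0, v - w) = (u, v) - (u, w) by apply: submoduleB.
by congr (_, _); rewrite /= subrr.
Qed.

Let good0 : good (fun p => D p.1 /\ p.2 = f p.1).
Proof.
split=> [|v /= [_ ->]|u v /= [Du ->]|u Du] //=; last exact: fZ.
  split=> [|a [u v] [u' v'] /= [Du ->] [Du' ->]].
    by split; [case: DS | rewrite /= (linear_on0 DS fL)].
  by split; [case: DS => _; apply | rewrite fL].
exact: linear_on0 DS fL.
Qed.

Let good_bigcup (F : set (set (N * E))) (X0 : set (N * E)) :
  F X0 -> good X0 -> (forall X, F X -> X = set0 \/ good X) -> total_on F subset ->
  good (\bigcup_(X in F) X)%classic.
Proof.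
move=> FX0 gX0 Fgood Ftot.
have gd X p : F X -> X p -> good X.
  by move=> FX Xp; case: (Fgood X FX) => // X_0; rewrite X_0 in Xp.
split=> [|v|u v|u Du].
- split; first by exists X0 => //; case: gX0 => -[].
  move=> a p q [X FX Xp] [Y FY Yq].
  have [XY|YX] := Ftot X Y FX FY.
    by exists Y => //; have [[_ h] _ _ _] := gd _ _ FY Yq; apply: h => //; apply: XY.
  by exists X => //; have [[_ h] _ _ _] := gd _ _ FX Xp; apply: h => //; apply: YX.
- by move=> [X FX Xv]; have [_ h _ _] := gd _ _ FX Xv; apply: h.
- by move=> [X FX Xv]; have [_ _ h _] := gd _ _ FX Xv; apply: (h u).
by exists X0 => //; case: gX0 => _ _ _; apply.
Qed.

(** By Zorn's lemma it suffices that every partial map with a proper domain D'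
extends to some D' + A y, which is possible when f' (a y) = a e on the ideal of
all a such that a y lies in D'. *)
Lemma extend_linear :
  (forall (D' : N -> Prop) (f' : N -> E),
     submodule D' -> linear_on D' f' -> (forall u, D' u -> Z (f' u)) ->
     (forall u, D u -> D' u) -> (exists u, ~ D' u) ->
     exists y e, [/\ ~ D' y, Z e
       & forall a, D' (a *: y) -> f' (a *: y) = a *: e]) ->
  exists g : {linear N -> E}, (forall u, D u -> g u = f u) /\ forall u, Z (g u).
Proof.
move=> step.
have [|G [Ggood Gmax]] := @Zorn_bigcup (N * E)%type
    (fun G : set (N * E) => G = set0 \/ good G).
  (* The empty graph is admitted because it is the union of the empty chain. *)
  move=> F FP Ftot.
  have [[X [FX gX]]|noX] := pselect (exists X, F X /\ good X).
    by right; apply: good_bigcup FX gX FP Ftot.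
  left; apply/seteqP; split=> // p [X FX Xp].
  case: (FP X FX) => [X0|gX]; first by rewrite X0 in Xp.
  by case: noX; exists X.
have {}Ggood : good G.
  case: Ggood => // G0; case: (Gmax _ _ (or_intror good0)).
  rewrite G0; split=> // /(_ (0, f 0)) h; apply: h.
  by split=> //; case: DS.
have [GS G0 GZ GD] := Ggood.
pose f' u := if pselect (exists v, G (u, v)) is left h then projT1 (cid h) else 0.
have f'G u v : G (u, v) -> f' u = v.
  move=> Guv; rewrite /f'; case: pselect => [h|[]]; last by exists v.
  by apply: good_functional Ggood (projT2 (cid h)) Guv.
have Gtot u : exists v, G (u, v).
  apply: contrapT => noG.
  have [|||||y [e [ny Ze ye]]] := step (fun u => exists v, G (u, v)) f'.
  - split=> [|a v w [v' Gv] [w' Gw]]; first by exists 0; case: GS.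
    by exists (a *: v' + w'); case: GS => _ /(_ a _ _ Gv Gw).
  - move=> a v w [v' Gv] [w' Gw]; rewrite (f'G v v') // (f'G w w') //.
    by apply: f'G; case: GS => _ /(_ a _ _ Gv Gw).
  - by move=> v [v' Gv]; rewrite (f'G v v') //; apply: GZ Gv.
  - by move=> v Dv; exists (f v); apply: GD.
  - by exists u.
  (* The graph of the extension to D' + A y would contradict maximality. *)
  apply: (Gmax (fun p => exists a v w,
     G (v, w) /\ p = (v + a *: y, w + a *: e))).
    split=> [[v w] Gvw|h].
      by exists 0, v, w; split=> //; rewrite !scale0r !addr0.
    apply: ny; exists e; apply: (h (y, e)); exists 1, 0, 0; split; first by case: GS.
    by rewrite !scale1r !add0r.
  right; split.
  - split; first by exists 0, 0, 0; split; [case: GS|rewrite !scale0r !addr0].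
    move=> b _ _ [a [v [w [Gvw ->]]]] [a' [v' [w' [Gvw' ->]]]].
    exists (b * a + a'), (b *: v + v'), (b *: w + w').
    split; first by case: GS => _ /(_ b _ _ Gvw Gvw').
    by congr (_, _); rewrite /= scalerDr scalerDl scalerA addrACA.
  - move=> z [a [v [w [Gvw [vy zE]]]]]; rewrite zE.
    have Gay : G (a *: y, - w).
      have -> : (a *: y, - w) = -1 *: (v, w).
        congr (_, _); rewrite /= scaleN1r //.
        by apply/eqP; rewrite -addr_eq0 addrC -vy.
      exact: submoduleZ.
    by rewrite -ye ?(f'G _ _ Gay) ?subrr //; exists (- w).
  - move=> z z' [a [v [w [Gvw [_ ->]]]]].
    by apply: submoduleD => //; [apply: GZ Gvw | apply: submoduleZ].
  - move=> v Dv; exists 0, v, (f v); split; first exact: GD.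
    by rewrite !scale0r !addr0.
have Gf' u : G (u, f' u) by have [v Gv] := Gtot u; rewrite (f'G _ _ Gv).
have f'L : linear f'.
  by move=> a u v; apply: f'G; case: GS => _ /(_ a _ _ (Gf' u) (Gf' v)).
pose fA := GRing.isLinear.Build A N E *:%R f' f'L.
pose g : {linear N -> E} := HB.pack f' fA.
exists g; split=> u; last exact: GZ (Gf' u).
by move=> Du; apply: f'G; apply: GD.
Qed.

End Extend.

Lemma baer_criterion (E : lmodType A) :
  (forall (J : A^o -> Prop) (f : A^o -> E), submodule J -> linear_on J f ->
    exists e, forall a, J a -> f a = a *: e) -> injective_module E.
Proof.
move=> baer M N i f inj_i.
pose D u := exists x, i x = u.
pose f0 u := if pselect (D u) is left h then f (projT1 (cid h)) else 0.
have f0E x : f0 (i x) = f x.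
  rewrite /f0; case: pselect => [h|[]]; last by exists x.
  by congr (f _); apply: inj_i; rewrite (projT2 (cid h)).
have [||||D' f' D'S f'L _ _ [y ny]|g [gE _]] :=
  @extend_linear N E D f0 (fun=> True).
- split=> [|a _ _ [u <-] [v <-]]; first by exists 0; rewrite linear0.
  by exists (a *: u + v); rewrite linearP.
- by move=> a _ _ [u <-] [v <-]; rewrite -linearP !f0E linearP.
- by [].
- by [].
- have [||e eP] := baer (fun a => D' (a *: y)) (fun a => f' (a *: y)).
  + split=> [|a b c Db Dc]; first by rewrite scale0r; case: D'S.
    by rewrite scalerDl -scalerA; case: D'S => _; apply.
  + by move=> a b c Db Dc; rewrite scalerDl -scalerA f'L.
  by exists y, e; split.
by exists g => x; rewrite gE ?f0E //; exists x.
Qed.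

End ModuleExtension.

(** A submodule seen as a module in its own right; the definition of injective
modules quantifies over modules, not over submodules. *)
Section Submodule.
Variables (A : comNzRingType) (V : lmodType A) (S : submodClosed V).

Record submodule_type := SubmoduleElt {
  submodule_val :> V;
  _ : submodule_val \in S
}.

HB.instance Definition _ := [isSub for submodule_val].
HB.instance Definition _ := [Choice of submodule_type by <:].
HB.instance Definition _ := [SubChoice_isSubLmodule of submodule_type by <:].

End Submodule.

Lemma injective_extend (A : comNzRingType) (E : lmodType A)
    (J : A^o -> Prop) (f : A^o -> E) :
  injective_module E -> submodule J -> linear_on J f ->
  exists e, forall a, J a -> f a = a *: e.
Proof.
move=> Einj JS fL; pose Jb : {pred A^o} := fun a => `[< J a >].
have Jc : submod_closed Jb.
  split=> [|a u v /asboolP Ju /asboolP Jv]; apply/asboolP; first by case: JS.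
  by case: JS => _; apply.
pose JbA := GRing.isSubmodClosed.Build A A^o Jb Jc.
pose Jm : submodClosed A^o := HB.pack Jb JbA.
pose M : lmodType A := submodule_type Jm.
pose fM (x : M) := f (val x).
have JM (x : M) : J (val x) by apply/asboolP; apply: (valP x).
have fML : linear fM by move=> a x y; rewrite /fM linearP; apply: fL; apply: JM.
pose fA := GRing.isLinear.Build A M E *:%R fM fML.
pose fl : {linear M -> E} := HB.pack fM fA.
have [g gE] := Einj M A^o (val : {linear M -> A^o}) fl val_inj.
exists (g 1) => a Ja.
have aJ : a \in Jm by apply/asboolP.
have := gE (SubmoduleElt aJ); rewrite -linearZ /= => h.
have -> : a *: (1 : A^o) = a by exact: mulr1.
by rewrite h.
Qed.

(** * A resolution of length one *)

Section FractionModule.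
Variables (A : comNzRingType) (F : fieldType) (iota : {rmorphism A -> F}).

(** The field F with the A-module structure given by iota. *)
Definition overfield : Type := F.
HB.instance Definition _ := GRing.Field.on overfield.

Definition overfield_scale (a : A) (x : overfield) : overfield := iota a * x.

Fact overfield_scaleA a b x :
  overfield_scale a (overfield_scale b x) = overfield_scale (a * b) x.
Proof. by rewrite /overfield_scale mulrA rmorphM. Qed.
Fact overfield_scale1 : left_id 1 overfield_scale.
Proof. by move=> x; rewrite /overfield_scale rmorph1 mul1r. Qed.
Fact overfield_scaleDr : right_distributive overfield_scale +%R.
Proof. by move=> a x y; rewrite /overfield_scale mulrDr. Qed.
Fact overfield_scaleDl x : {morph overfield_scale^~ x : a b / a + b}.
Proof. by move=> a b; rewrite /overfield_scale rmorphD mulrDl. Qed.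

HB.instance Definition _ := GRing.Zmodule_isLmodule.Build A overfield
  overfield_scaleA overfield_scale1 overfield_scaleDr overfield_scaleDl.

Lemma overfieldZ (a : A) (x : overfield) : a *: x = iota a * x.
Proof. by []. Qed.

Definition iota_image : {pred overfield} := fun x => `[< exists a, iota a = x >].

Lemma iota_image_closed : submod_closed iota_image.
Proof.
split=> [|a _ _ /asboolP[b <-] /asboolP[c <-]]; apply/asboolP.
  by exists 0; rewrite rmorph0.
by exists (a * b + c); rewrite rmorphD rmorphM.
Qed.
HB.instance Definition _ :=
  GRing.isSubmodClosed.Build A overfield iota_image iota_image_closed.

Definition field_quotient : Type := Quotient.quot iota_image.
HB.instance Definition _ := GRing.Zmodule.on field_quotient.

Definition to_quotient (x : overfield) : field_quotient :=
  (\pi_(Quotient.quot iota_image) x)%qT.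

Lemma to_quotientD : {morph to_quotient : x y / x + y}.
Proof. by move=> x y; rewrite /to_quotient raddfD. Qed.

Lemma to_quotient_surj y : exists x, to_quotient x = y.
Proof. by exists (repr (y : Quotient.quot iota_image)); rewrite /to_quotient reprK. Qed.

Lemma to_quotient_eq x y :
  to_quotient x = to_quotient y <-> exists a, iota a = x - y.
Proof.
rewrite /to_quotient; split=> [/eqP|h].
  by rewrite -Quotient.idealrBE => /asboolP.
by apply/eqP; rewrite -Quotient.idealrBE; apply/asboolP.
Qed.

Definition quotient_scale (a : A) (y : field_quotient) : field_quotient :=
  to_quotient (a *: (repr (y : Quotient.quot iota_image) : overfield)).

Lemma quotient_scaleE a x : quotient_scale a (to_quotient x) = to_quotient (a *: x).
Proof.
apply/to_quotient_eq; have /to_quotient_eq[b hb] :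
  to_quotient (repr (to_quotient x : Quotient.quot iota_image)) = to_quotient x.
  by rewrite /to_quotient reprK.
by exists (a * b); rewrite rmorphM hb -mulrBr.
Qed.

Fact quotient_scaleA a b x :
  quotient_scale a (quotient_scale b x) = quotient_scale (a * b) x.
Proof. by have [{}x <-] := to_quotient_surj x; rewrite !quotient_scaleE scalerA. Qed.
Fact quotient_scale1 : left_id 1 quotient_scale.
Proof. by move=> x; have [{}x <-] := to_quotient_surj x; rewrite quotient_scaleE scale1r. Qed.
Fact quotient_scaleDr : right_distributive quotient_scale +%R.
Proof.
move=> a x y; have [{}x <-] := to_quotient_surj x; have [{}y <-] := to_quotient_surj y.
by rewrite -to_quotientD !quotient_scaleE scalerDr to_quotientD.
Qed.
Fact quotient_scaleDl x : {morph quotient_scale^~ x : a b / a + b}.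
Proof.
move=> a b; have [{}x <-] := to_quotient_surj x.
by rewrite !quotient_scaleE scalerDl to_quotientD.
Qed.
HB.instance Definition _ := GRing.Zmodule_isLmodule.Build A field_quotient
  quotient_scaleA quotient_scale1 quotient_scaleDr quotient_scaleDl.

Fact to_quotient_linear : linear to_quotient.
Proof. by move=> a x y; rewrite to_quotientD /GRing.scale /= quotient_scaleE. Qed.
HB.instance Definition _ := GRing.isLinear.Build A overfield field_quotient *:%R
  to_quotient to_quotient_linear.

Fact iota_linear : linear (iota : A^o -> overfield).
Proof. by move=> a x y; rewrite rmorphD rmorphM. Qed.

(** A linear map f from an ideal to F is multiplication by f x / x for any
nonzero x in the ideal, since x f(a) = f(a x) = a f(x). *)
Lemma overfield_injective : injective iota -> injective_module overfield.
Proof.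
move=> iota_inj; apply: baer_criterion => J f JS fL.
have [[x [Jx x0]]|J0] := pselect (exists x, J x /\ x != 0).
  have ix0 : iota x != 0 by rewrite -(rmorph0 iota) (inj_eq iota_inj).
  exists (f x / iota x) => a Ja; rewrite overfieldZ mulrA.
  apply: (canRL (mulfK ix0)); rewrite mulrC -!overfieldZ.
  rewrite -(linear_onZ _ JS fL Ja) -(linear_onZ _ JS fL Jx).
  by congr f; apply: mulrC.
exists 0 => a Ja; have [->|a0] := eqVneq a 0.
  by rewrite (linear_on0 JS fL) scaler0.
by case: J0; exists a.
Qed.

(** Baer's condition for F/A, in terms of representatives in F of the values of
a linear map. *)
Hypothesis iota_inj : injective iota.
Hypothesis quotient_baer : forall (J : A^o -> Prop) (f : A -> F),
  submodule J ->
  (forall a u v : A, J u -> J v ->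
     exists b, f (a * u + v) = iota a * f u + f v + iota b) ->
  exists q, forall a : A, J a -> exists b, f a = iota a * q + iota b.

Lemma field_quotient_injective : injective_module field_quotient.
Proof.
apply: baer_criterion => J f JS fL.
pose f' a : F := repr (f a : Quotient.quot iota_image).
have f'E a : to_quotient (f' a) = f a by rewrite /to_quotient reprK.
have [||q qP] := @quotient_baer J f' => //.
  move=> a u v Ju Jv; have : to_quotient (f' (a * u + v)) =
                    to_quotient (iota a * f' u + f' v).
    rewrite f'E -overfieldZ to_quotientD linearZ /= !f'E.
    exact: fL.
  by case/to_quotient_eq => b bE; exists b; rewrite bE [RHS]addrC subrK.
exists (to_quotient q) => a Ja; rewrite -linearZ -f'E; apply/to_quotient_eq.
by have [b ->] := qP a Ja; exists b; rewrite overfieldZ addrC addKr.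
Qed.

Definition fraction_resolution (i : nat) : lmodType A :=
  match i with 0 => overfield | 1 => field_quotient | _ => 'M[A]_(0, 0) end.

Definition fraction_differential (i : nat) :
    {linear fraction_resolution i -> fraction_resolution i.+1} :=
  match i with 0 => to_quotient | _ => \0 end.

Lemma injdim_le1 : injdim_le (A^o : lmodType A) 1.
Proof.
pose iL := GRing.isLinear.Build A A^o overfield *:%R (iota : A^o -> overfield) iota_linear.
pose eps : {linear A^o -> fraction_resolution 0} := HB.pack (iota : A^o -> overfield) iL.
exists fraction_resolution, eps, fraction_differential; split.
- case=> [|[|i]] /=; [exact: overfield_injective|exact: field_quotient_injective|].
  by move=> M N g f _; exists \0 => x; apply/matrixP => -[].
- exact: iota_inj.
- move=> x /=; rewrite -(linear0 to_quotient).
  by rewrite to_quotient_eq subr0.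
- case=> [|i] /= x; last first.
    by split=> // _; exists 0; apply/matrixP => -[].
  by split=> // _; exact: to_quotient_surj.
by case=> [|[|i]] // _ x; apply/matrixP => -[].
Qed.

End FractionModule.

(** * Finite injective dimension forces a cyclic socle *)

Section FiniteInjectiveDimension.
Variable A : comNzRingType.

Definition baer_at (J : A^o -> Prop) (E : lmodType A) (Z : E -> Prop) : Prop :=
  forall f : A^o -> E, linear_on J f -> (forall a, J a -> Z (f a)) ->
  exists u, Z u /\ forall a, J a -> f a = a *: u.

(** The setting is a local ring A with maximal ideal m, a regular element x, and
an element s that represents a nonzero socle element of A/xA.  The last
hypothesis expresses that every nonzero quotient of A/xA has a nonzero socle, as
holds when A/xA has finite length. *)
Variables (m : A^o -> Prop) (x s : A).
Hypothesis mS : submodule m.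
Hypothesis m_or_unit : forall a : A, m a \/ exists b, a * b = 1.
Hypothesis x_regular : forall a, x * a = 0 -> a = 0.
Hypothesis s_notin : ~ exists a, s = x * a.
Hypothesis m_s : forall a : A, m a -> exists b, a * s = x * b.
Hypothesis m_filtration : forall J : A^o -> Prop, submodule J -> J x -> ~ J 1 ->
  exists y : A, ~ J y /\ forall a : A, m a -> J (a * y).

Let colon_m (a : A) : (exists b, a * s = x * b) -> m a.
Proof.
move=> [b as_xb]; have [//|[c ac]] := m_or_unit a; case: s_notin.
by exists (b * c); rewrite mulrA -as_xb mulrAC ac mul1r.
Qed.

Let pair (a : A^o) : Prop := exists al be : A, a = al * s + be * x.

Let pairS : submodule pair.
Proof.
split; first by exists 0, 0; rewrite !mul0r addr0.
move=> a _ _ [al [be ->]] [al' [be' ->]].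
exists (a * al + al'), (a * be + be').
by rewrite /GRing.scale /= mulrDr !mulrDl !mulrA addrACA.
Qed.

(** The quotient of the ideal (s, x) by (x) is isomorphic to A/m, so that an
element killed by m defines a map on (s, x) that sends s to it and x to 0. *)
Let pair_map (E : lmodType A) (u : E) : (forall a, m a -> a *: u = 0) ->
  exists2 f : A^o -> E, linear_on pair f
    & forall al be : A, f (al * s + be * x) = al *: u.
Proof.
move=> mu.
pose P (a al : A) := exists be : A, a = al * s + be * x.
pose f (a : A) := if pselect (exists al, P a al) is left h
           then projT1 (cid h) *: u else 0.
have fE al be : f (al * s + be * x) = al *: u.
  rewrite /f; case: pselect => [h|[]]; last by exists al, be.
  case: (cid h) => al' [be' /= e]; apply/eqP; rewrite -subr_eq0 -scalerBl.
  apply/eqP/mu/colon_m; exists (be - be'); apply: (@subr0_eq A).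
  have <- : (al' * s + be' * x) - (al * s + be * x) = 0 :> A by rewrite e subrr.
  by ring.
exists f => // a _ _ [al [be ->]] [al' [be' ->]].
have -> : a *: (al * s + be * x : A^o) + (al' * s + be' * x) =
  (a * al + al') * s + (a * be + be') * x.
  by rewrite /GRing.scale /= mulrDr !mulrDl !mulrA addrACA.
by rewrite !fE scalerDl scalerA.
Qed.

Let lift_socle (E : lmodType A) (Z : E -> Prop) (u : E) :
  baer_at pair Z -> submodule Z -> Z u -> (forall a, m a -> a *: u = 0) ->
  exists w, [/\ Z w, s *: w = u & x *: w = 0].
Proof.
move=> baer ZS Zu mu; have [f fL fE] := pair_map mu.
have [|w [Zw wE]] := baer f fL.
  by move=> _ [al [be ->]]; rewrite fE; apply: submoduleZ.
exists w; split=> //.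
  have := fE 1 0; rewrite mul1r mul0r addr0 scale1r => <-.
  by rewrite wE //; exists 1, 0; rewrite mul1r mul0r addr0.
have := fE 0 1; rewrite mul1r mul0r add0r scale0r => <-.
by rewrite wE //; exists 0, 1; rewrite mul1r mul0r add0r.
Qed.

(** A map f : m -> Z is a |-> a u for some u in E.  The class of u modulo Z is a
socle element of Z', which is s w' for some w' killed by x; divisibility of Z
lifts w' to an element of E killed by x, and s times this lift is a socle
element of E by which u can be corrected to an element of Z. *)
Let socle_step (E E' : lmodType A) (d : {linear E -> E'}) (Z : E -> Prop)
    (Z' : E' -> Prop) :
  submodule Z' -> injective_module E -> (forall e, Z e <-> d e = 0) ->
  (forall e', Z' e' <-> exists e, d e = e') ->
  (forall e, Z e -> exists2 c, Z c & e = x *: c) ->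
  baer_at pair Z' -> baer_at m Z.
Proof.
move=> Z'S Einj Zd Z'd Zdiv baer f fL fZ.
have [u uE] := injective_extend Einj mS fL.
have [||w' [Z'w' sw' xw']] := lift_socle (u := d u) baer Z'S.
- by apply/Z'd; exists u.
- by move=> a ma; rewrite -linearZ /= -uE //; apply/Zd/fZ.
have /Z'd[w wE] := Z'w'; move: sw' xw'; rewrite -wE -!linearZ /= => sw xw.
have /Zd/Zdiv[c Zc xwc] := xw.
exists (u - s *: (w - c)); split.
  apply/Zd; rewrite linearB /= -sw -linearB /= -scalerBr opprB addrC subrK.
  by rewrite linearZ /=; move/Zd: Zc => ->; rewrite scaler0.
move=> a ma; rewrite scalerBr -uE //; have [b asb] := m_s ma.
by rewrite scalerA asb mulrC -scalerA scalerBr -xwc subrr scaler0 subr0.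
Qed.

(** Starting from J, a map is extended by one element y at a time, where y is
killed by m modulo the current domain; each step is an extension from m. *)
Let filtration_step (E : lmodType A) (Z : E -> Prop) (J : A^o -> Prop) :
  submodule Z -> baer_at m Z -> submodule J -> J x -> baer_at J Z.
Proof.
move=> ZS baer JS Jx f fL fZ.
have [|g [gE gZ]] := extend_linear JS fL ZS fZ; last first.
  exists (g 1); split=> // a Ja; rewrite -gE // -linearZ /=.
  by congr (g _); symmetry; apply: mulr1.
move=> J' f' J'S f'L f'Z JJ' [c nc].
have [||y [ny my]] := m_filtration J'S; first exact: JJ'.
  by move=> J1; apply: nc; rewrite -[c]mulr1; apply: (submoduleZ c J'S J1).
have [||e [Ze eE]] := baer (fun a => f' (a * y)).
- move=> a u v mu mv; rewrite -f'L; [|exact: my..].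
  by congr f'; rewrite mulrDl -mulrA.
- by move=> a ma; apply/f'Z/my.
exists y, e; split=> // a Jay; apply: eE.
have [//|[b ab]] := m_or_unit a; case: ny.
have -> : y = b * (a * y) by rewrite mulrA [b * a]mulrC ab mul1r.
exact: submoduleZ.
Qed.

(** The element t is another representative of a socle element of A/xA.  As E 0
is divisible by x, it contains some u with x u = 1, and the x-torsion of E 0 / A
contains the copy of A/xA generated by u.  The map s |-> t u, x |-> 0 from (s, x)
to E 0 / A is a |-> a v for some v in E 0.  Then b = x v is in A, and multiplying
s v - t u, which is in A, by x yields s b - t in xA. *)
Lemma finite_injdim_socle (t : A) : finite_injdim (A^o : lmodType A) ->
  (forall a : A, m a -> exists b, a * t = x * b) ->
  exists a b, t = s * b + x * a.
Proof.
move=> [n [E [eps [d [Einj eps_inj d0 dS Ebig]]]]] m_t.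
have kerS i : submodule (fun e => d i e = 0).
  by split=> [|a u v du dv]; rewrite ?linear0 ?linearP ?du ?dv ?scaler0 ?addr0.
have Ediv i (e : E i) : exists c, e = x *: c.
  pose J (a : A^o) := exists b : A, a = b * x.
  pose f (a : A) := if pselect (J a) is left h then projT1 (cid h) *: e else 0.
  have fE b : f (b * x) = b *: e.
    rewrite /f; case: pselect => [h|[]]; last by exists b.
    case: (cid h) => b' /= be; congr (_ *: _); apply/eqP; rewrite -subr_eq0.
    by apply/eqP/x_regular; rewrite mulrBr mulrC -be mulrC subrr.
  have JS : submodule J.
    split=> [|a _ _ [b ->] [c ->]]; first by exists 0; rewrite mul0r.
    by exists (a * b + c); rewrite mulrDl -mulrA.
  have fL : linear_on J f.
    move=> a _ _ [b ->] [c ->].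
    have -> : a *: (b * x : A^o) + c * x = (a * b + c) * x.
      by rewrite mulrDl -mulrA.
    by rewrite !fE scalerDl scalerA.
  have [c cE] := injective_extend (Einj i) JS fL; exists c.
  have := fE 1; rewrite mul1r scale1r => <-.
  by apply: cE; exists 1; rewrite mul1r.
(* The descending induction starts above the length of the resolution, where
   all modules vanish. *)
have baer i (J : A^o -> Prop) :
    submodule J -> J x -> baer_at J (fun e : E i.+1 => d i.+1 e = 0).
  have [k] := ubnP (n - i); elim: k i J => // k IHk i J; rewrite ltnS => lek JS Jx.
  have [ni|ni] := ltnP n i.+1.
    move=> f _ _; exists 0; split; first by rewrite linear0.
    by move=> a _; apply/eqP; rewrite -subr_eq0; apply/eqP/(Ebig _ ni).
  apply: filtration_step => //.
  apply: (@socle_step _ _ (d i.+1) _ (fun e => d i.+2 e = 0)) => //.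
    move=> e /dS[z <-]; have [c ->] := Ediv i z.
    by exists (d i c); [apply/dS; exists c | rewrite linearZ].
  apply: IHk => //; first by apply: leq_trans lek; rewrite ltn_sub2l.
  by exists 0, 1; rewrite mul0r mul1r add0r.
have [u xu] := Ediv 0%N (eps 1).
have d_eps b : d 0%N (eps b) = 0 by apply/d0; exists b.
have epsZ (a : A) (b : A^o) : eps (a * b) = a *: eps b by rewrite -linearZ.
have epsE (b : A) : eps b = (b * x) *: u.
  by rewrite -scalerA -xu -epsZ mulr1.
have [||||w [dw sw xw]] := lift_socle (u := d 0%N (t *: u)) (baer 0%N pair pairS _).
- by exists 0, 1; rewrite mul0r mul1r add0r.
- exact: kerS.
- by apply/dS; exists (t *: u).
- move=> a ma; have [b atb] := m_t a ma.
  by rewrite -linearZ /= scalerA atb mulrC -epsE.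
have /dS[v vw] := dw; move: sw xw; rewrite -vw -!linearZ /= => sv xv.
have /d0[b xb] := xv.
have /d0[a aE] : d 0%N (s *: v - t *: u) = 0 by rewrite linearB /= sv subrr.
have : s * b - t = x * a :> A.
  apply: eps_inj; rewrite [in RHS]epsZ aE linearB /= epsZ xb epsE.
  by rewrite scalerBr !scalerA [x * s]mulrC [x * t]mulrC.
move=> e; exists (- a), b; rewrite mulrN -e.
by rewrite opprB addrC subrK.
Qed.

End FiniteInjectiveDimension.

(** * Semigroup rings *)

Section SemigroupRingTheory.
Variables (K : fieldType) (G : {pred nat}).
Local Notation S := (semigroup_gen G).
Local Notation R := (semigroup_ring K G).

Lemma semigroup_ring_inj (r s : R) : r = s :> {poly K} -> r = s.
Proof. exact: val_inj. Qed.

Lemma poly0E : (0 : R) = 0 :> {poly K}. Proof. exact: (rmorph0 val). Qed.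
Lemma poly1E : (1 : R) = 1 :> {poly K}. Proof. exact: (rmorph1 val). Qed.
Lemma polyDE (r s : R) : (r + s : R) = (r : {poly K}) + s :> {poly K}.
Proof. exact: (rmorphD val). Qed.
Lemma polyBE (r s : R) : (r - s : R) = (r : {poly K}) - (s : {poly K}) :> {poly K}.
Proof. exact: (rmorphB val). Qed.
Lemma polyME (r s : R) : (r * s : R) = (r : {poly K}) * s :> {poly K}.
Proof. exact: (rmorphM val). Qed.
Lemma poly_sumE I (t : seq I) P (F : I -> R) :
  (\sum_(i <- t | P i) F i : R) = \sum_(i <- t | P i) (F i : {poly K}) :> {poly K}.
Proof. exact: (rmorph_sum val). Qed.

Definition polyE := (poly0E, poly1E, polyBE, polyDE, polyME).

Lemma semigroup_ring_support (r : R) i : i \notin S -> r`_i = 0.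
Proof.
by move=> iS; apply: contraNeq iS; move/semigroup_polyP: (valP r); apply.
Qed.

(** The value 0 on polynomials outside the ring is a default. *)
Definition to_semigroup_ring (p : {poly K}) : R := insubd 0 p.

Lemma to_semigroup_ringK (p : {poly K}) :
  (forall i, p`_i != 0 -> i \in S) -> to_semigroup_ring p = p :> {poly K}.
Proof. by move=> pS; apply: insubdK; apply/semigroup_polyP. Qed.

Definition monom (i : nat) : R := to_semigroup_ring 'X^i.

Lemma monomE i : i \in S -> monom i = 'X^i :> {poly K}.
Proof.
move=> iS; apply: to_semigroup_ringK => j; rewrite coefXn.
by case: (j =P i) => [->//|_]; rewrite eqxx.
Qed.

Lemma monom0 : monom 0 = 1.
Proof. by apply: semigroup_ring_inj; rewrite monomE ?semigroup_gen0 // expr0 polyE. Qed.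

Lemma monomD i j : i \in S -> j \in S -> monom (i + j) = monom i * monom j.
Proof.
move=> iS jS; apply: semigroup_ring_inj.
by rewrite polyE !monomE ?semigroup_genD // exprD.
Qed.

Definition semigroup_const (c : K) : R := to_semigroup_ring c%:P.

Lemma semigroup_constE c : semigroup_const c = c%:P :> {poly K}.
Proof.
apply: to_semigroup_ringK => -[|i]; rewrite coefC ?eqxx //.
by rewrite semigroup_gen0.
Qed.

Lemma semigroup_ring_expand (r : R) :
  r = \sum_(i < size r) semigroup_const r`_i * monom i.
Proof.
apply: semigroup_ring_inj; rewrite poly_sumE -[LHS]coefK poly_def.
apply: eq_bigr => i _; rewrite polyE semigroup_constE mul_polyC.
have [->|ri] := eqVneq r`_i 0; first by rewrite !scale0r.
rewrite monomE //; apply: contraNT ri => iS.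
by rewrite semigroup_ring_support.
Qed.

Lemma semigroup_ring_mul_eq0 (r s : R) : r * s = 0 -> r != 0 -> s = 0.
Proof.
move=> rs0 r0; apply: semigroup_ring_inj; apply: (mulfI (x := r : {poly K})).
  by apply: contra r0 => /eqP r0; apply/eqP/semigroup_ring_inj.
by rewrite -polyE rs0 polyE mulr0.
Qed.

Definition origin : {pred R} := fun r => r`_0 == 0.

(** Modulo this ideal every element is a constant, and constants are invertible. *)
Lemma origin_maximal : maximal_ideal origin.
Proof.
split.
  split=> [||a u v /eqP u0 /eqP v0]; rewrite !unfold_in ?polyE ?coef0 //.
    by rewrite coef1 oner_eq0.
  by rewrite coefD coef0M u0 v0 mulr0 addr0.
move=> J [J0 J1 JC] PJ r Jr; apply: contraNT J1; rewrite unfold_in => r0.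
have Jc : r - (r - semigroup_const r`_0) \in J.
  rewrite addrC -mulN1r; apply: JC => //; apply: PJ.
  by rewrite unfold_in polyE coefB semigroup_constE coefC eqxx subrr.
have {Jc} := JC (semigroup_const (r`_0)^-1) _ _ Jc J0.
suff -> : semigroup_const (r`_0)^-1 * (r - (r - semigroup_const r`_0)) + 0 = 1 by [].
apply: semigroup_ring_inj; rewrite addr0 subKr !polyE !semigroup_constE -polyCM mulVf //.
Qed.

(** * Two pseudo-Frobenius numbers *)

Section NonSymmetric.
Variables (A : comNzRingType) (phi : {rmorphism R -> A}).
Hypothesis phiP : is_localization_at origin phi.

Let phi_unit (g : R) : g`_0 != 0 -> exists b, phi g * b = 1.
Proof. by case: phiP => h _ _ g0; apply: h; rewrite unfold_in. Qed.

Let phi_frac a : exists r g : R, g`_0 != 0 /\ a * phi g = phi r.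
Proof. by case: phiP => _ /(_ a)[r [g gP ag]] _; exists r, g. Qed.

Let phi_inj : injective phi.
Proof.
move=> r r' /eqP; rewrite -subr_eq0 -rmorphB => /eqP; case: phiP => _ _ h /h.
move=> [g gP gr]; apply/eqP; rewrite -subr_eq0; apply/eqP.
apply: semigroup_ring_mul_eq0 gr _; apply: contraNneq gP => ->.
by rewrite unfold_in polyE coef0.
Qed.

Let phi_reg (g : R) a : g`_0 != 0 -> a * phi g = 0 -> a = 0.
Proof.
by move=> /phi_unit[b gb] ag; rewrite -[a]mulr1 -gb mulrA ag mul0r.
Qed.

(** The maximal ideal of the localization. *)
Let m (a : A^o) : Prop := exists r g : R,
  [/\ r`_0 = 0, g`_0 != 0 & (a : A) * phi g = phi r].

Let mS : submodule m.
Proof.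
split=> [|a u v [r [g [r0 g0 ug]]] [r' [g' [r'0 g'0 vg']]]].
  exists 0, 1; rewrite !polyE coef0 coef1 oner_eq0.
  by split=> //; rewrite mul0r rmorph0.
have [q [t [t0 at_]]] := phi_frac a.
exists (q * r * g' + r' * g * t), (g * g' * t); split.
- by rewrite !polyE coefD !coef0M r0 r'0 mulr0 !mul0r addr0.
- by rewrite !polyE !coef0M !mulf_neq0.
rewrite rmorphD !rmorphM -at_ -ug -vg' /GRing.scale /=.
by ring.
Qed.

Let m_or_unit (a : A) : m a \/ exists b, a * b = 1.
Proof.
have [r [g [g0 ag]]] := phi_frac a.
have [r0|r0] := eqVneq r`_0 0; first by left; exists r, g.
have [b rb] := phi_unit r0; right; exists (phi g * b).
by rewrite mulrA ag.
Qed.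

(** With x = t^e, a pseudo-Frobenius number F yields the socle element t^(F+e) of
A/xA.  A relation t^(F2+e) = t^(F1+e) b + t^e a with F2 < F1 is impossible, as
comparing coefficients in degree F2+e shows after clearing denominators. *)
Lemma finite_injdim_pseudo_frobenius e F1 F2 :
  (0 < e)%N -> e \in S -> (exists c, forall i, (c <= i)%N -> i \in S) ->
  F1 \notin S -> F2 \notin S ->
  (forall i, (0 < i)%N -> i \in S -> (F1 + i)%N \in S) ->
  (forall i, (0 < i)%N -> i \in S -> (F2 + i)%N \in S) ->
  (F2 < F1)%N -> ~ finite_injdim (A^o : lmodType A).
Proof.
move=> e0 eS [c cS] F1S F2S F1P F2P F21 fin.
have m_pf F : (forall i, (0 < i)%N -> i \in S -> (F + i)%N \in S) ->
    forall a : A, m a -> exists b, a * phi (monom (F + e)) = phi (monom e) * b.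
  move=> FP a [r [g [r0 g0 ag]]]; have [b gb] := phi_unit g0.
  have rF : to_semigroup_ring ((r : {poly K}) * 'X^F) = (r : {poly K}) * 'X^F :> {poly K}.
    apply: to_semigroup_ringK => i; rewrite coefMXn; case: ltnP => [|Fi]; rewrite ?eqxx //.
    move=> rn0; rewrite -(subnKC Fi); apply: FP.
      by rewrite lt0n; apply: contraNneq rn0 => ->; rewrite r0.
    by apply: contraNT rn0 => /semigroup_ring_support ->.
  exists (phi (to_semigroup_ring ((r : {poly K}) * 'X^F)) * b).
  rewrite mulrA -rmorphM.
  have -> : monom e * to_semigroup_ring ((r : {poly K}) * 'X^F) = r * monom (F + e).
    apply: semigroup_ring_inj; rewrite !polyE rF !monomE ?FP // exprD.
    by ring.
  rewrite rmorphM -ag -[LHS]mulr1 -gb; ring.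
have x_regular a : phi (monom e) * a = 0 -> a = 0.
  have [r [g [g0 ag]]] := phi_frac a => xa; apply: (phi_reg g0).
  suff r0 : r = 0 by rewrite ag r0 rmorph0.
  apply: (@semigroup_ring_mul_eq0 (monom e)).
    by apply: phi_inj; rewrite rmorphM -ag mulrA xa mul0r rmorph0.
  apply/eqP => me0; have /eqP := monomE eS.
  by rewrite me0 polyE eq_sym expf_eq0 polyX_eq0 andbF.
have s_notin : ~ exists a, phi (monom (F1 + e)) = phi (monom e) * a.
  move=> [a]; have [r [g [g0 ag]]] := phi_frac a.
  move/(congr1 ( *%R^~ (phi g))); rewrite -mulrA ag -!rmorphM => /phi_inj.
  move/(congr1 (fun z : R => z`_(F1 + e))).
  rewrite !polyE !monomE ?F1P // !coefXnM ltnn subnn ltnNge leq_addl /= addnK.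
  by rewrite (semigroup_ring_support _ F1S) => /eqP; rewrite (negPf g0).
have [|a [b]] := finite_injdim_socle mS m_or_unit x_regular s_notin (m_pf _ F1P) _
  fin (m_pf _ F2P).
  move=> J JS Jx J1.
  (* The largest M in S such that t^M is not in J gives y = t^M: multiplying it
     by an element of m only produces monomials of larger degree. *)
  pose Q i := (i \in S) && ~~ `[< J (phi (monom i)) >].
  have JC a z : J z -> J (a * z) by move=> Jz; apply: (submoduleZ a JS Jz).
  have [||M /andP[MS /asboolPn MJ] Mmax] := @ex_maxnP Q (e + c).
  - exists 0%N; rewrite /Q semigroup_gen0; apply/asboolPn.
    by rewrite monom0 rmorph1.
  - move=> i /andP[iS]; apply: contraNT; rewrite -ltnNge => ltci; apply/asboolP.
    have ei : (e <= i)%N by lia.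
    rewrite -(subnK ei) monomD ?rmorphM //; first exact: JC.
    by apply: cS; lia.
  exists (phi (monom M)); split=> // a [r [g [r0 g0 ag]]].
  have [b gb] := phi_unit g0.
  have -> : a * phi (monom M) = b * phi (r * monom M).
    by rewrite rmorphM -ag -[LHS]mulr1 -gb; ring.
  apply: (JC); rewrite [r]semigroup_ring_expand mulr_suml rmorph_sum /=.
  apply: big_ind => [|u v|i _]; first by case: JS.
    by move=> Ju Jv; apply: (submoduleD JS Ju Jv).
  have [->|ri] := eqVneq r`_i 0.
    have -> : semigroup_const 0 = 0 by apply: semigroup_ring_inj; rewrite semigroup_constE polyE.
    by rewrite !mul0r rmorph0; case: JS.
  have iS : (i : nat) \in S.
    by apply: contraNT ri => /semigroup_ring_support ->.
  rewrite -mulrA -monomD // rmorphM; apply: JC; apply: contrapT => nJ.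
  have /Mmax : Q (i + M)%N.
    by rewrite /Q semigroup_genD //; apply/asboolPn.
  have : i != 0%N :> nat by apply: contraNneq ri => ->; rewrite r0.
  lia.
have [r [g [g0 ag]]] := phi_frac b; have [r' [g' [g'0 ag']]] := phi_frac a.
move=> tE; have /phi_inj :
    phi (monom (F2 + e) * (g * g')) =
    phi (monom (F1 + e) * (r * g') + monom e * (r' * g)).
  by rewrite rmorphD !rmorphM tE -ag -ag'; ring.
move/(congr1 (fun z : R => z`_(F2 + e))).
rewrite !polyE !monomE ?F1P ?F2P // coefD !coefXnM ltnn subnn.
rewrite ltn_add2r F21 add0r ltnNge leq_addl /= addnK -(polyME r').
rewrite (semigroup_ring_support _ F2S) coef0M => /eqP.
by rewrite mulf_eq0 (negPf g0) (negPf g'0).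
Qed.

End NonSymmetric.

Lemma gorenstein_pseudo_frobenius e F1 F2 :
  (0 < e)%N -> e \in S -> (exists c, forall i, (c <= i)%N -> i \in S) ->
  F1 \notin S -> F2 \notin S ->
  (forall i, (0 < i)%N -> i \in S -> (F1 + i)%N \in S) ->
  (forall i, (0 < i)%N -> i \in S -> (F2 + i)%N \in S) ->
  (F2 < F1)%N -> ~ gorenstein R.
Proof.
move=> e0 eS cS F1S F2S F1P F2P F21 [_ /(_ _ origin_maximal)[A [phi [phiP fin]]]].
exact: (finite_injdim_pseudo_frobenius phiP e0 eS cS F1S F2S).
Qed.

End SemigroupRingTheory.

(** * The noetherian property *)

(** The colon ideal (P : r) contains P and, if r is not in P, it is proper. *)
Lemma maximal_ideal_prime (R : comNzRingType) (P : {pred R}) (r s : R) :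
  maximal_ideal P -> r * s \in P -> r \notin P -> s \in P.
Proof.
move=> [[P0 P1 PC] Pmax] rsP rP.
apply: (Pmax (fun a => a * r \in P)); last by rewrite unfold_in mulrC.
  split=> [||a u v]; rewrite !unfold_in ?mul0r ?mul1r // => uP vP.
  by rewrite mulrDl -mulrA; apply: PC.
by move=> a aP; rewrite unfold_in mulrC -[_ * _]addr0; apply: PC.
Qed.

Section Noetherian.
Variables (K : fieldType) (G : {pred nat}).
Local Notation S := (semigroup_gen G).
Local Notation R := (semigroup_ring K G).

(** For each residue i modulo e, choose an element g i of I that is of minimal
degree among those of degree congruent to i.  Since t^e is in the ring, the
leading term of any element of I is cancelled by a multiple of some g i. *)
Lemma semigroup_ring_noetherian e : (0 < e)%N -> e \in S -> noetherian R.
Proof.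
move=> e0 eS I [I0 I1 IC].
have IB u v : u \in I -> v \in I -> u - v \in I.
  by move=> uI vI; rewrite addrC -mulN1r; apply: IC.
have IM a u : u \in I -> a * u \in I by move=> uI; rewrite -[_ * _]addr0; apply: IC.
have keS k : (k * e)%N \in S.
  elim: k => [|k IHk]; first exact: semigroup_gen0.
  by rewrite mulSn semigroup_genD.
have /choice[g gP] : forall i : 'I_e, exists g : R, g \in I /\
    forall f : R, f \in I -> f != 0 -> ((size f).-1 %% e)%N = i ->
    [/\ g != 0, ((size g).-1 %% e)%N = i & (size g <= size f)%N].
  move=> i.
  pose Q d := `[< exists f : R, [/\ f \in I, f != 0, ((size f).-1 %% e)%N = i & size f = d] >].
  have [Qd|noQ] := pselect (exists d, Q d); last first.
    exists 0; split=> // f fI f0 fi; case: noQ; exists (size f).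
    by apply/asboolP; exists f.
  have [d /asboolP[g [gI g0 gi gd]] dmin] := ex_minnP Qd.
  exists g; split=> // f fI f0 fi; split=> //; rewrite gd; apply: dmin.
  by apply/asboolP; exists f.
(* Duplicates are removed because the coefficient of a generator is a function
   of its value. *)
pose s := undup [seq g i | i <- enum 'I_e].
exists s.
  by move=> z; rewrite mem_undup => /mapP[i _ ->]; case: (gP i).
move=> f; have [k] := ubnP (size f); elim: k f => // k IHk f; rewrite ltnS => fk fI.
have [->|f0] := eqVneq f 0.
  by exists (fun=> 0); rewrite big1 // => h _; rewrite mul0r.
pose i : 'I_e := Ordinal (ltn_pmod (size f).-1 e0).
have [gI /(_ f fI f0 erefl)[g0 gi gf]] := gP i.
have pf0 : (f : {poly K}) != 0 by apply: contra f0 => /eqP h; apply/eqP/semigroup_ring_inj; rewrite polyE.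
have pg0 : (g i : {poly K}) != 0 by apply: contra g0 => /eqP h; apply/eqP/semigroup_ring_inj; rewrite polyE.
have sf : (0 < size f)%N by rewrite size_poly_gt0.
have sg : (0 < size (g i))%N by rewrite size_poly_gt0.
pose D := (size f - size (g i))%N.
have DS : D \in S.
  have -> : D = (((size f).-1 - (size (g i)).-1) %/ e * e)%N; last exact: keS.
  have : (e %| (size f).-1 - (size (g i)).-1)%N.
    by rewrite -eqn_mod_dvd ?gi //; clear -gf; lia.
  by move/divnK ->; rewrite /D; clear -gf sg sf; lia.
pose a : R := semigroup_const G (lead_coef f / lead_coef (g i)) * monom K G D.
have aE : a = lead_coef f / lead_coef (g i) *: 'X^D :> {poly K}.
  by rewrite polyE semigroup_constE monomE // mul_polyC.
have small : (size (f - a * g i)%R < k)%N.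
  apply: leq_trans fk; rewrite -[X in (_ < X)%N](prednK sf) ltnS.
  apply/leq_sizeP => j fj; rewrite polyBE polyME aE coefB -scalerAl coefZ coefXnM.
  have -> : (j < D)%N = false by rewrite /D; clear -fj sg sf; lia.
  move: fj; rewrite leq_eqVlt => /predU1P[<-|fj].
    have -> : ((size f).-1 - D = (size (g i)).-1)%N by rewrite /D; clear -gf sg sf; lia.
    by rewrite -/(lead_coef _) mulfVK ?lead_coef_eq0 // subrr.
  have fj' : (size f <= j)%N by clear -fj sf; lia.
  have gj : (size (g i) <= j - D)%N by rewrite /D; clear -gf fj' fj; lia.
  by rewrite !nth_default // mulr0 subr0.
have [|c cE] := IHk _ small; first by apply: IB => //; apply: IM.
exists (fun h => c h + (if h == g i then a else 0)).
have gs : g i \in s by rewrite mem_undup; apply: map_f; rewrite mem_enum.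
under eq_bigr do rewrite mulrDl.
rewrite big_split /= -cE (bigD1_seq (g i)) ?undup_uniq //= eqxx.
by rewrite big1 ?addr0 ?subrK // => h /negPf ->; rewrite mul0r.
Qed.

End Noetherian.

(** * Localizations at maximal ideals *)

Section Subring.
Variables (F : fieldType) (T : subringClosed F).

Record subring_type := SubringElt {
  subring_val :> F;
  _ : subring_val \in T
}.

HB.instance Definition _ := [isSub for subring_val].
HB.instance Definition _ := [Choice of subring_type by <:].
HB.instance Definition _ := [SubChoice_isSubComNzRing of subring_type by <:].

End Subring.

Section Localization.
Variables (K : fieldType) (G : {pred nat}).
Local Notation S := (semigroup_gen G).
Local Notation R := (semigroup_ring K G).
Local Notation F := {fraction {poly K}}.
Local Notation "p %:F" := (tofrac p).

(** The localization is realized as a ring of fractions inside K(t), which also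
provides the embedding iota into a field. *)
Lemma localization_exists (P : {pred R}) : maximal_ideal P ->
  exists (A : comNzRingType) (phi : {rmorphism R -> A}) (iota : {rmorphism A -> F}),
    [/\ is_localization_at P phi, injective iota
      & forall r : R, iota (phi r) = (r : {poly K})%:F].
Proof.
move=> Pmax; have [[P0 P1 PC] _] := Pmax.
have PM r s : r \notin P -> s \notin P -> r * s \notin P.
  by move=> rP; apply: contra => /(maximal_ideal_prime Pmax); apply.
have nz (s : R) : s \notin P -> (s : {poly K})%:F != 0.
  move=> sP; rewrite tofrac_eq0; apply: contraNneq sP => s0.
  by have -> : s = 0 by apply: semigroup_ring_inj; rewrite polyE.
pose T : {pred F} := fun x => `[< exists r s : R,
  s \notin P /\ x = (r : {poly K})%:F / (s : {poly K})%:F >].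
have TE (r s : R) : s \notin P -> (r : {poly K})%:F / (s : {poly K})%:F \in T.
  by move=> sP; apply/asboolP; exists r, s.
have Tc : subring_closed T.
  split=> [|_ _ /asboolP[r [s [sP ->]]] /asboolP[r' [s' [sP' ->]]]
           |_ _ /asboolP[r [s [sP ->]]] /asboolP[r' [s' [sP' ->]]]].
  - by have := TE 1 1 P1; rewrite polyE tofrac1 divr1.
  - have := TE (r * s' - r' * s) (s * s') (PM _ _ sP sP').
    by rewrite !polyE tofracB !tofracM -mulNr -addf_div ?nz // mulNr.
  have := TE (r * r') (s * s') (PM _ _ sP sP').
  by rewrite !polyE !tofracM mulf_div.
pose TA := GRing.isSubringClosed.Build F T Tc.
pose Ts : subringClosed F := HB.pack T TA.
pose A : comNzRingType := subring_type Ts.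
have rT (r : R) : (r : {poly K})%:F \in Ts.
  by have := TE r 1 P1; rewrite polyE tofrac1 divr1.
pose f (r : R) : A := SubringElt (rT r).
have val_f r : val (f r) = (r : {poly K})%:F by [].
have fB : zmod_morphism f.
  by move=> r s; apply: val_inj; rewrite rmorphB !val_f polyBE tofracB.
have fM : monoid_morphism f.
  split=> [|r s]; apply: val_inj; rewrite ?rmorph1 ?rmorphM ?val_f ?polyE.
    by rewrite tofrac1.
  by rewrite tofracM.
pose fBA := GRing.isZmodMorphism.Build R A f fB.
pose fMA := GRing.isMonoidMorphism.Build R A f fM.
pose phi : {rmorphism R -> A} := HB.pack f fBA fMA.
exists A, phi, (val : {rmorphism A -> F}); split=> //; last exact: val_inj.
split=> [s sP|a|r r0].
- have sV : (s : {poly K})%:F^-1 \in Ts.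
    by have := TE 1 s sP; rewrite polyE tofrac1 mul1r.
  exists (SubringElt sV); apply: val_inj; rewrite rmorphM /=.
  by rewrite mulfV ?nz.
- have /asboolP[r [s [sP aE]]] := valP a; exists r; exists s => //.
  by apply: val_inj; rewrite rmorphM /= [X in X * _]aE mulfVK ?nz.
exists 1 => //; rewrite mul1r; apply: semigroup_ring_inj; rewrite polyE.
apply/eqP; rewrite -tofrac_eq0; apply/eqP.
by have := congr1 val r0; rewrite rmorph0.
Qed.

(** All powers of t^s lie in P as soon as one does, and t^e and t^s have a common
power for every positive s; hence P contains the ideal of the origin. *)
Lemma maximal_ideal_origin (P : {pred R}) e :
  maximal_ideal P -> (0 < e)%N -> e \in S -> monom K G e \in P ->
  forall r : R, (r \in P) = (r`_0 == 0).
Proof.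
move=> Pmax e0 eS eP; have [[P0 P1 PC] _] := Pmax.
have keS k s : s \in S -> (k * s)%N \in S.
  move=> sS; elim: k => [|k IHk]; first exact: semigroup_gen0.
  by rewrite mulSn semigroup_genD.
have PM a u : u \in P -> a * u \in P by move=> uP; rewrite -[_ * _]addr0; apply: PC.
have PD u v : u \in P -> v \in P -> u + v \in P by move=> uP vP; rewrite -[u]mul1r; apply: PC.
have monP s : (0 < s)%N -> s \in S -> monom K G s \in P.
  move=> s0 sS; apply/negPn/negP => sP.
  suff /negP[] : monom K G (e * s) \notin P.
    rewrite mulnC; case: s s0 sS {sP} => // s _ sS.
    by rewrite mulSn monomD ?keS // mulrC; apply: PM.
  elim: (e) => [|k IHk]; first by rewrite mul0n monom0.
  rewrite mulSn monomD ?keS //; apply: contra IHk => h.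
  exact: (maximal_ideal_prime Pmax h sP).
have OP : {subset @origin K G <= P}.
  move=> r; rewrite unfold_in => /eqP r0; rewrite [r]semigroup_ring_expand.
  apply: (big_ind (fun z => z \in P)) => // i _; have [->|ri] := eqVneq r`_i 0.
    have -> : semigroup_const G (0 : K) = 0 by apply: semigroup_ring_inj; rewrite semigroup_constE polyE.
    by rewrite mul0r.
  apply: PM; apply: monP.
    by rewrite lt0n; apply: contraNneq ri => ->; rewrite r0.
  by apply: contraNT ri => /semigroup_ring_support ->.
move=> r; apply/idP/idP; last exact: OP.
by have [_ /(_ _ (proj1 Pmax) OP)] := origin_maximal K G; apply.
Qed.

(** Inverting g modulo t^N by a geometric series: g = g(0) (1 - y) where y has no
constant term, and y^(N+c) is divisible by t^(N+c) in K[t], hence by t^N in R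
because S contains all degrees from c on. *)
Lemma origin_inverse (g : R) N c :
  (forall i, (c <= i)%N -> i \in S) -> N \in S -> g`_0 != 0 ->
  exists v w : R, g * v = 1 - monom K G N * w.
Proof.
move=> cS NS g0; set k := semigroup_const G (g`_0)^-1.
pose y := 1 - k * g; pose y' := drop_poly 1 (y : {poly K}).
have y0 : y`_0 = 0.
  rewrite /y polyBE polyME polyE semigroup_constE coefB coef1 coefCM mulVf //.
  by rewrite subrr.
have yE : (y : {poly K}) = y' * 'X.
  apply/polyP => -[|i]; rewrite coefMX ?y0 //= coef_drop_poly addn1 //.
have yn n : (y ^+ n : R) = y' ^+ n * 'X^n :> {poly K}.
  elim: n => [|n IHn]; first by rewrite !expr0 polyE mulr1.
  by rewrite exprS polyME IHn yE exprS [in RHS]exprS; ring.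
have wE : to_semigroup_ring G (y' ^+ (N + c) * 'X^c) = y' ^+ (N + c) * 'X^c :> {poly K}.
  apply: to_semigroup_ringK => i; rewrite coefMXn.
  by case: ltnP => [|ci _]; [rewrite eqxx | apply: cS].
exists (k * \sum_(i < N + c) y ^+ i), (to_semigroup_ring G (y' ^+ (N + c) * 'X^c)).
have -> : monom K G N * to_semigroup_ring G (y' ^+ (N + c) * 'X^c) = y ^+ (N + c).
  by apply: semigroup_ring_inj; rewrite polyME wE monomE // yn ['X^(N + c)]exprD; ring.
rewrite -[RHS]opprB subrX1 mulrA -mulNr; congr (_ * _).
by rewrite opprB /y subKr mulrC.
Qed.

(** The function f represents a linear map from the ideal J to F/A by
elements of F; the goal is to find q such that it is a |-> a q. *)
Section QuotientExtension.
Variables (P : {pred R}) (A : comNzRingType).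
Variables (phi : {rmorphism R -> A}) (iota : {rmorphism A -> F}).
Hypotheses (Pmax : maximal_ideal P) (phiP : is_localization_at P phi).
Hypothesis iota_inj : injective iota.
Hypothesis iota_phi : forall r : R, iota (phi r) = (r : {poly K})%:F.
Variables (J : A^o -> Prop) (f : A -> F).
Hypothesis JS : submodule J.
Hypothesis fL : forall a u v : A, J u -> J v ->
  exists b, f (a * u + v) = iota a * f u + f v + iota b.

Let JM (a u : A) : J u -> J (a * u).
Proof. by move=> Ju; apply: (submoduleZ a JS Ju). Qed.

Let fM (a u : A) : J u -> exists b, f (a * u) = iota a * f u + iota b.
Proof.
move=> Ju; have [J0 _] := JS; have [b0] := fL 1 J0 J0.
rewrite mul1r rmorph1 mul1r addr0 => h0.
have {}h0 : f 0 = - iota b0.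
  by apply/eqP; rewrite -addr_eq0; apply/eqP/(@addrI _ (f 0)); rewrite addrA addr0 -h0.
have [b] := fL a Ju J0; rewrite addr0 h0 -addrA -rmorphN -rmorphD => ->.
by exists (- b0 + b).
Qed.

Let unit_notin (g : R) : g \notin P -> exists b, phi g * b = 1.
Proof. by case: phiP => h _ _; apply: h. Qed.

Let nz (g : R) : g \notin P -> (g : {poly K})%:F != 0.
Proof.
move=> gP; rewrite tofrac_eq0; apply: contraNneq gP => g0.
have -> : g = 0 by apply: semigroup_ring_inj; rewrite polyE.
by have [[P0 _ _] _] := Pmax.
Qed.

Let f_zero : exists b, f 0 = iota b.
Proof.
have [J0 _] := JS; have [b] := fM 0 J0; rewrite mul0r rmorph0 mul0r add0r => ->.
by exists b.
Qed.

Let phi_inj : injective phi.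
Proof.
move=> r s rs; apply: semigroup_ring_inj; apply/eqP; rewrite -tofrac_eq.
by rewrite -!iota_phi rs.
Qed.

Let zero_ideal_extension : (forall a : A, J a -> a = 0) ->
  exists q, forall a : A, J a -> exists b, f a = iota a * q + iota b.
Proof.
move=> J_0; exists 0 => a Ja; have [b f0] := f_zero; exists b.
by rewrite (J_0 a Ja) f0 mulr0 add0r.
Qed.

(** Some t^N with N beyond the conductor c is not in P, so that A contains K[t].
A polynomial p of minimal degree in J generates J, and q = f(p) / p. *)
Lemma regular_point_extension e c :
  e \in S -> (0 < e)%N -> (forall i, (c <= i)%N -> i \in S) ->
  monom K G e \notin P ->
  exists q, forall a : A, J a -> exists b, f a = iota a * q + iota b.
Proof.
move=> eS e0 cS eP.
have [N [NS Nc NP]] : exists N, [/\ N \in S, (c <= N)%N & monom K G N \notin P].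
  exists (c * e)%N; elim: (c) => [|k [kS kc kP]].
    rewrite mul0n monom0; have [[_ P1 _] _] := Pmax.
    by split; rewrite ?semigroup_gen0.
  split; rewrite mulSn ?semigroup_genD //; first lia.
  rewrite monomD //; apply: contra kP => /(maximal_ideal_prime Pmax); exact.
have poly_lift (p : {poly K}) : exists a, iota a = p%:F.
  have pE : to_semigroup_ring G ('X^N * p) = 'X^N * p :> {poly K}.
    apply: to_semigroup_ringK => i; rewrite coefXnM.
    by case: ltnP => [|Ni _]; [rewrite eqxx | apply: cS; apply: leq_trans Ni].
  have [b Nb] := unit_notin NP.
  exists (phi (to_semigroup_ring G ('X^N * p)) * b).
  apply: (mulfI (nz NP)); rewrite -iota_phi -rmorphM mulrCA Nb mulr1 !iota_phi.
  by rewrite pE monomE // tofracM.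
pose J' (p : {poly K}) := exists2 a : A, J a & iota a = p%:F.
have JJ' (a : A) : J a -> exists r g : R, [/\ g \notin P, a * phi g = phi r & J' r].
  move=> Ja; case: phiP => _ /(_ a)[r [g gP ag]] _; exists r, g; split=> //.
  by exists (phi r); rewrite ?iota_phi // -ag mulrC; apply: JM.
have [[p0 p0n0 Jp0]|noJ] := pselect (exists2 p, p != 0 & J' p); last first.
  apply: zero_ideal_extension => a Ja; have [r [g [gP ag Jr]]] := JJ' a Ja.
  have r0 : (r : {poly K}) = 0.
    by apply: contrapT => /eqP r0; case: noJ; exists (r : {poly K}).
  have [b gb] := unit_notin gP; rewrite -[a]mulr1 -gb mulrA ag.
  have -> : r = 0 by apply: semigroup_ring_inj; rewrite polyE.
  by rewrite rmorph0 mul0r.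
pose Q d := `[< exists p, [/\ p != 0, J' p & size p = d] >].
have [|d /asboolP[p [pn0 [a0 Ja0 a0p] pd]] dmin] := @ex_minnP Q.
  by exists (size p0); apply/asboolP; exists p0.
have pF0 : p%:F != 0 by rewrite tofrac_eq0.
exists (f a0 / p%:F) => a Ja; have [r [g [gP ag [a1 Ja1 a1r]]]] := JJ' a Ja.
have [h hE] := poly_lift ((r : {poly K}) %/ p).
have rE : (r : {poly K}) %% p = 0.
  apply/eqP; apply: contraTT (ltn_modpN0 r pn0) => r0; rewrite -leqNgt pd dmin //.
  apply/asboolP; exists ((r : {poly K}) %% p); split=> //.
  exists ((- h) * a0 + a1).
    by have [_ JD] := JS; apply: (JD (- h) a0 a1).
  rewrite rmorphD rmorphM rmorphN hE a0p a1r {2}(divp_eq r p).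
  by rewrite tofracD tofracM mulNr addKr.
have [b gb] := unit_notin gP.
have aE : a = (h * b) * a0.
  apply: iota_inj; rewrite !rmorphM hE a0p.
  have gbF : (g : {poly K})%:F * iota b = 1 by rewrite -iota_phi -rmorphM gb rmorph1.
  have agF : iota a * (g : {poly K})%:F = (r : {poly K})%:F.
    by rewrite -!iota_phi -rmorphM ag.
  have rF : (r : {poly K})%:F = ((r : {poly K}) %/ p)%:F * p%:F.
    by rewrite -tofracM -[RHS]addr0 -tofrac0 -rE -tofracD -divp_eq.
  by rewrite -[LHS]mulr1 -gbF mulrA agF rF mulrAC.
have [b' b'E] := fM (h * b) Ja0; rewrite -aE in b'E; exists b'.
rewrite b'E; congr (_ + _); rewrite aE [in RHS]rmorphM a0p -mulrA.
by rewrite [p%:F * _]mulrC divfK.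
Qed.

Section Origin.
Variable Fr : nat.
Hypothesis PE : forall r : R, (r \in P) = (r`_0 == 0).
Hypothesis FS : Fr \notin S.
Hypothesis bigS : forall i, (Fr < i)%N -> i \in S.
Hypothesis symS : forall i, (i <= Fr)%N -> i \notin S -> (Fr - i)%N \in S.

Let unitP (g : R) : g`_0 != 0 -> exists b, phi g * b = 1.
Proof. by move=> g0; apply: unit_notin; rewrite PE. Qed.

Let frac (a : A) : exists r g : R, g`_0 != 0 /\ a * phi g = phi r.
Proof. by case: phiP => _ /(_ a)[r [g gP ag]] _; exists r, g; rewrite -PE. Qed.

(** A nonzero element of J may be taken to be a polynomial r = t^k u with u(0)
nonzero.  If v is an inverse of u modulo t^(Fr+1), then r t^(Fr+1) v is
t^(k+Fr+1) times w = u v, and w is a unit of A. *)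
Lemma ideal_contains_monomial (a0 : A) : J a0 -> a0 <> 0 ->
  exists N, (Fr < N)%N /\ J (phi (monom K G N)).
Proof.
move=> Ja0 a0n0.
have [r [g [g0 ag]]] := frac a0.
have Jr : J (phi r) by rewrite -ag mulrC; apply: JM.
have rn0 : exists i, r`_i != 0.
  exists (size r).-1; rewrite -/(lead_coef r) lead_coef_eq0.
  apply/eqP => r0; apply: a0n0; have [b gb] := unitP g0.
  have r_0 : r = 0 by apply: semigroup_ring_inj; rewrite polyE.
  by rewrite -[a0]mulr1 -gb mulrA ag r_0 rmorph0 mul0r.
have [k rk kmin] := ex_minnP rn0; pose u := drop_poly k (r : {poly K}).
have rE : (r : {poly K}) = u * 'X^k.
  apply/polyP => i; rewrite coefMXn coef_drop_poly; case: ltnP => [ik|ki].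
    by apply: contraTeq ik => /kmin; rewrite -leqNgt.
  by rewrite subnK.
have u0 : u`_0 != 0 by rewrite coef_drop_poly.
have cop : coprimep u 'X^(Fr.+1).
  by rewrite coprimep_expr // coprimepX /root horner_coef0.
have /Bezout_eq1_coprimepP[[v z] /= vz] := cop.
exists (k + Fr.+1)%N; split; first by rewrite addnS ltnS leq_addl.
have inR (p : {poly K}) : to_semigroup_ring G ('X^(Fr.+1) * p) = 'X^(Fr.+1) * p :> {poly K}.
  apply: to_semigroup_ringK => i; rewrite coefXnM.
  by case: ltnP => [|Fi _]; [rewrite eqxx | apply: bigS].
pose w : R := 1 - to_semigroup_ring G ('X^(Fr.+1) * z).
have wE : (w : {poly K}) = v * u.
  by rewrite polyBE polyE inR -vz mulrC; ring.
have w0 : w`_0 != 0.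
  by rewrite polyBE polyE inR coefB coef1 coefXnM subr0 oner_neq0.
have [b wb] := unitP w0.
have -> : phi (monom K G (k + Fr.+1)) = b * phi (to_semigroup_ring G ('X^(Fr.+1) * v)) * phi r.
  have e : monom K G (k + Fr.+1) * w = to_semigroup_ring G ('X^(Fr.+1) * v) * r.
    apply: semigroup_ring_inj; rewrite !polyME wE inR monomE ?rE ?exprD; first ring.
    by apply: bigS; rewrite addnS ltnS leq_addl.
  by rewrite -mulrA -rmorphM -e rmorphM mulrCA [b * _]mulrC wb mulr1.
exact: JM.
Qed.

(** In the proof, al a stands for x times the corrected value of f at a, and B r p says
that the polynomial p represents al (phi r) modulo x A.  The functional T is the
coefficient of degree Fr+N.  It kills x A because Fr is a gap, and by symmetry
only the elements of x A have all their multiples killed by T. *)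
Lemma origin_extension :
  exists q, forall a : A, J a -> exists b, f a = iota a * q + iota b.
Proof.
have [[a0 [Ja0 a0n0]]|J_0] := pselect (exists a : A, J a /\ a <> 0); last first.
  by apply: zero_ideal_extension => a Ja; apply: contrapT => an0; apply: J_0; exists a.
have [N [NF NJ]] := ideal_contains_monomial Ja0 a0n0.
have NS : N \in S by apply: bigS.
pose x := phi (monom K G N).
have Jx : J x by [].
have xn0 : iota x != 0 by rewrite iota_phi monomE // tofrac_eq0 expf_eq0 polyX_eq0 andbF.
pose q0 := f x / iota x.
have /choice[al alE] : forall a : A, exists al : A, J a -> iota al = iota x * (f a - iota a * q0).
  move=> a; have [Ja|nJ] := pselect (J a); last by exists 0.
  have [b b_eq] := fM x Ja; have [b' b'_eq] := fM a Jx.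
  have e : iota x * f a + iota b = iota a * f x + iota b'.
    by rewrite -b_eq -b'_eq mulrC.
  exists (b' - b) => _; rewrite rmorphB mulrBr mulrCA [iota x * q0]mulrC divfK //.
  by apply: (canLR (addrK _)); rewrite addrAC e addrC addKr.
have al_lin (a u v : A) : J u -> J v -> exists b, al (a * u + v) = a * al u + al v + x * b.
  move=> Ju Jv; have [b bE] := fL a Ju Jv; exists b; apply: iota_inj.
  have Jauv : J (a * u + v) by case: JS => _ /(_ a u v Ju Jv).
  rewrite alE // !rmorphD !rmorphM !alE // bE; ring.
have al_x : al x = 0.
  apply: iota_inj; rewrite alE // rmorph0 [iota x * q0]mulrC divfK //.
  by rewrite subrr mulr0.
have [J0 _] := JS.
have al_0 : exists b, al 0 = x * b.
  have [b fb] := f_zero; exists b; apply: iota_inj.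
  by rewrite alE // rmorphM fb rmorph0 mul0r subr0.
pose T (p : R) := p`_(Fr + N).
pose B (r p : R) := exists b, al (phi r) = phi p + x * b.
have T_wd p b : phi p = x * b -> T p = 0.
  (* If b = r/g then p g = t^N r, and replacing p by p g v, where v is an inverse
     of g modulo t^(Fr+N+1), gives p = t^N (r v) up to degree Fr+N. *)
  have [r [g [g0 bg]]] := frac b => pE.
  have MS : (Fr + N).+1 \in S by apply: bigS; rewrite ltnS leq_addr.
  have [v [w gv]] := origin_inverse bigS MS g0.
  have gp : p * g = monom K G N * r.
    by apply: phi_inj; rewrite !rmorphM pE -mulrA bg.
  have -> : p = monom K G N * (r * v) + monom K G (Fr + N).+1 * (p * w).
    by rewrite mulrA -gp -mulrA gv; ring.
  rewrite /T polyDE coefD !(polyME (monom _ _ _)) !monomE // !coefXnM.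
  rewrite ltnNge leq_addl ltnS leqnn /= addr0 addnK.
  by rewrite -(polyME r) semigroup_ring_support.
have TB (p p' : R) : T (p - p') = T p - T p' by rewrite /T polyBE coefB.
have B_ex r : exists p, B r p.
  have [s [g [g0 ag]]] := frac (al (phi r)).
  have [v [w gv]] := origin_inverse bigS NS g0.
  exists (s * v), (al (phi r) * phi w).
  have : phi (g * v) + x * phi w = 1.
    by rewrite gv rmorphB rmorph1 [phi (_ * w)]rmorphM subrK.
  move=> gvw; rewrite -[LHS]mulr1 -gvw mulrDr !rmorphM mulrA ag; ring.
have B_uniq r p p' : B r p -> B r p' -> T p = T p'.
  move=> [b bE] [b' b'E]; apply/eqP; rewrite -subr_eq0 -TB; apply/eqP.
  apply: (@T_wd _ (b' - b)); rewrite rmorphB mulrBr.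
  by apply: (canLR (addrK _)); rewrite addrAC -[x * b' + _]addrC -b'E bE addrK.
have B_lin a r s p p' : J (phi r) -> J (phi s) -> B r p -> B s p' ->
    B (a * r + s) (a * p + p').
  move=> Jr Js [b bE] [b' b'E]; have [c cE] := al_lin (phi a) _ _ Jr Js.
  exists (phi a * b + b' + c); rewrite !rmorphD !rmorphM cE bE b'E; ring.
have B00 : B 0 0 by have [b bE] := al_0; exists b; rewrite !rmorph0 add0r.
have B_mul a r p : J (phi r) -> B r p -> B (a * r) (a * p).
  by move=> Jr Bp; rewrite -[a * r]addr0 -[a * p]addr0; apply: B_lin; rewrite ?rmorph0.
have /choice[rep repP] := B_ex.
pose D (p : {poly K}) := exists2 r : R, J (phi r) & p = r.
pose lam (p : {poly K}) : K^o := T (rep (to_semigroup_ring G p)).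
have lamE r p : B r p -> lam r = T p.
  move=> Bp; rewrite /lam; have -> : to_semigroup_ring G r = r.
    by apply: semigroup_ring_inj; apply: to_semigroup_ringK; apply/semigroup_polyP/(valP r).
  exact: B_uniq (repP r) Bp.
have constM c (r s : R) : c *: (r : {poly K}) + (s : {poly K}) = (semigroup_const G c * r + s : R).
  by rewrite polyDE polyME semigroup_constE mul_polyC.
have DS : submodule D.
  split=> [|c _ _ [r Jr ->] [s Js ->]]; first by exists 0; rewrite ?polyE ?rmorph0.
  exists (semigroup_const G c * r + s) => //; rewrite rmorphD rmorphM.
  by case: JS => _ /(_ (phi (semigroup_const G c)) _ _ Jr Js).
have lamL : linear_on D lam.
  move=> c _ _ [r Jr ->] [s Js ->]; rewrite constM.
  rewrite (lamE _ _ (B_lin (semigroup_const G c) _ _ _ _ Jr Js (repP r) (repP s))).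
  rewrite (lamE _ _ (repP r)) (lamE _ _ (repP s)) /T.
  by rewrite polyDE polyME semigroup_constE coefD coefCM.
(* Over the field K an ideal that contains a nonzero scalar is everything, so
   that any functional extends. *)
have [||D' f' D'S f'L _ _ [y ny]|mu [muE _]] :=
    @extend_linear K {poly K} K^o D lam (fun=> True) DS lamL; rewrite //.
  exists y, 0; split=> // a Day; rewrite scaler0.
  have [->|an0] := eqVneq a 0; first by rewrite scale0r (linear_on0 D'S f'L).
  case: ny; have := submoduleZ a^-1 D'S Day.
  by rewrite scalerA mulVf // scale1r.
have mu_r r p : J (phi r) -> B r p -> mu r = T p.
  by move=> Jr Bp; rewrite muE ?(lamE _ _ Bp) //; exists r.
have mu_0 (h : R) : mu ('X^N * (h : {poly K})) = 0.
  rewrite -(monomE K NS) -polyME mulrC (mu_r _ (h * 0)).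
  - by rewrite mulr0 /T polyE coef0.
  - by rewrite rmorphM; apply: JM.
  apply: B_mul => //; exists 0; rewrite rmorph0 mulr0 addr0; exact: al_x.
pose q : {poly K} := \poly_(j < (Fr + N).+1)
   (if (Fr + N - j)%N \in S then mu 'X^(Fr + N - j) else 0 : K).
(* If j is a gap then Fr+N-j = N + (Fr-j) with Fr-j in S, where mu vanishes
   because mu kills t^N R. *)
have qE : to_semigroup_ring G q = q :> {poly K}.
  apply: to_semigroup_ringK => j; rewrite coef_poly ltnS.
  case: leqP => [jFN|_]; last by rewrite eqxx.
  case: ifP => [_|]; last by rewrite eqxx.
  apply: contraR => jS.
  have jF : (j <= Fr)%N by rewrite leqNgt; apply: contra jS => /bigS.
  have FjS := symS jF jS.
  have -> : (Fr + N - j = N + (Fr - j))%N by lia.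
  by rewrite exprD -(monomE K FjS) mu_0.
(* The degrees above Fr+N contribute nothing to either side: mu kills them. *)
have rq (r : R) : T (r * to_semigroup_ring G q) = mu r.
  rewrite /T polyME qE coefM -{2}(poly_take_drop (Fr + N).+1 (r : {poly K})).
  rewrite linearD /=.
  have -> : drop_poly (Fr + N).+1 (r : {poly K}) * 'X^((Fr + N).+1) =
     'X^N * (to_semigroup_ring G ('X^(Fr.+1) * drop_poly (Fr + N).+1 (r : {poly K})) : {poly K}).
    rewrite to_semigroup_ringK; last first.
      move=> i; rewrite coefXnM.
      by case: ltnP => [|Fi _]; [rewrite eqxx | apply: bigS].
    by rewrite -addSn exprD; ring.
  rewrite mu_0 addr0 /take_poly poly_def linear_sum /=; apply: eq_bigr => i _.
  rewrite linearZ /= coef_poly ltnS leq_subr subKn; last by rewrite -ltnS.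
  have [->|ri] := eqVneq (r`_i) 0; first by rewrite scale0r mul0r.
  case: ifPn => // iS.
  by rewrite semigroup_ring_support // eqxx in ri.
have al_q (r : R) : J (phi r) -> exists b, al (phi r) = phi r * phi (to_semigroup_ring G q) + x * b.
  move=> Jr; have [p Bp] := B_ex r; have [b bE] := Bp.
  pose h := p - r * to_semigroup_ring G q.
  have Th r' : T (r' * h) = 0.
    rewrite /h mulrBr TB mulrA rq (mu_r _ (r' * p)) ?subrr //; last exact: B_mul.
    by rewrite rmorphM; apply: JM.
  have Th' i j : i \in S -> (i + j = Fr + N)%N -> h`_j = 0.
    move=> iS ij; have := Th (monom K G i).
    by rewrite /T polyME monomE // -ij coefXnM ltnNge leq_addr /= addKn.
  have h'E : to_semigroup_ring G (drop_poly N (h : {poly K})) = drop_poly N (h : {poly K}) :> {poly K}.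
    apply: to_semigroup_ringK => i; rewrite coef_drop_poly.
    apply: contraR => iS; apply/eqP.
    have iF : (i <= Fr)%N by rewrite leqNgt; apply: contra iS => /bigS.
    apply: (Th' (Fr - i)%N); [exact: symS | lia].
  (* The coefficient of h in degree j is T (t^(Fr+N-j) h), and this monomial is
     in R if j < N or if j-N is a gap. *)
  have hE : h = monom K G N * to_semigroup_ring G (drop_poly N (h : {poly K})).
    apply: semigroup_ring_inj; rewrite polyME monomE // h'E.
    apply/polyP => i; rewrite coefXnM coef_drop_poly; case: ltnP => Ni.
      by apply: (Th' (Fr + N - i)%N); [apply: bigS | ]; lia.
    by rewrite subnK.
  exists (phi (to_semigroup_ring G (drop_poly N (h : {poly K}))) + b).
  rewrite bE mulrDr addrA -rmorphM -[x * phi _]rmorphM -hE -rmorphD.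
  by rewrite /h [_ + (p - _)]addrC subrK.
exists (iota (phi (to_semigroup_ring G q)) / iota x + q0) => a Ja.
have [r [g [g0 ag]]] := frac a; have [ga gga] := unitP g0.
have Jr : J (phi r) by rewrite -ag mulrC; apply: JM.
have [b bE] := al_q r Jr; have [c] := al_lin (phi g) _ _ Ja J0.
have [b0 b0E] := al_0; rewrite addr0 [phi g * a]mulrC ag bE b0E => cE.
set Q := phi (to_semigroup_ring G q) in bE cE *.
exists (ga * (b - b0 - c)).
have gal : phi g * al a = phi r * Q + x * (b - b0 - c).
  apply: (@addIr _ (x * b0 + x * c)); rewrite addrA -cE; ring.
have alQ : al a = a * Q + x * (ga * (b - b0 - c)).
  rewrite -[al a]mul1r -gga -[phi g * ga]mulrC -mulrA gal -ag.
  rewrite mulrDr [a * phi g]mulrC -mulrA mulrA [ga * phi g]mulrC gga mul1r.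
  by rewrite mulrCA.
apply: (mulfI xn0); move/(congr1 iota): alQ; rewrite alE // rmorphD !rmorphM => e.
have {}e : iota x * f a = iota a * iota Q + iota x * (iota ga * iota (b - b0 - c))
    + iota x * (iota a * q0).
  by rewrite -e; ring.
rewrite e; have xV : iota x / iota x = 1 by rewrite mulfV.
rewrite [RHS]mulrDr [in RHS]mulrDr [in RHS]mulrDr.
have -> : iota x * (iota a * (iota Q / iota x)) = iota a * iota Q * (iota x / iota x).
  by ring.
by rewrite xV mulr1 addrAC.
Qed.

End Origin.

End QuotientExtension.
End Localization.

(** * Gorenstein semigroup rings and the semigroups S(e,m,n) *)

Lemma gorenstein_symmetric (K : fieldType) (G : {pred nat}) e Fr :
  (0 < e)%N -> e \in semigroup_gen G -> Fr \notin semigroup_gen G ->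
  (forall i, (Fr < i)%N -> i \in semigroup_gen G) ->
  (forall i, (i <= Fr)%N -> i \notin semigroup_gen G ->
     (Fr - i)%N \in semigroup_gen G) ->
  gorenstein (semigroup_ring K G).
Proof.
move=> e0 eS FS bigS symS; split; first exact: semigroup_ring_noetherian e0 eS.
move=> P Pmax; have [A [phi [iota [phiP iota_inj iota_phi]]]] := localization_exists Pmax.
exists A, phi; split=> //; exists 1%N; apply: (injdim_le1 iota_inj) => J f JS fL.
have [eP|eP] := boolP (monom K G e \in P).
  have PE := maximal_ideal_origin Pmax e0 eS eP.
  exact: (origin_extension phiP iota_inj iota_phi JS fL PE FS bigS symS).
exact: (regular_point_extension Pmax phiP iota_inj iota_phi JS fL eS e0 bigS eP).
Qed.

Local Open Scope nat_scope.

Lemma mem_semigroup_gen (G : {pred nat}) i : i \in G -> i \in semigroup_gen G.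
Proof.
move=> iG; apply/asboolP; exists [:: i]; last by rewrite /= addn0.
by move=> j; rewrite inE => /eqP ->.
Qed.

(** Translating by e covers everything above e consecutive elements. *)
Lemma semigroup_gen_interval (G : {pred nat}) e L :
  0 < e -> e \in G -> (forall i, L <= i < L + e -> i \in semigroup_gen G) ->
  forall i, L <= i -> i \in semigroup_gen G.
Proof.
move=> e0 eG LS i; have [k] := ubnP i; elim: k i => // k IHk i ik Li.
have [|iLe] := ltnP i (L + e); first by move=> h; apply: LS; rewrite Li.
have ei : e <= i by lia.
rewrite -(subnK ei); apply: semigroup_genD; last exact: mem_semigroup_gen.
by apply: IHk; lia.
Qed.

Section Sally.
Variables (e m n : nat).
Hypotheses (m1 : 1 <= m) (mn : m < n) (ne : n <= e - 2).
Local Notation S := (semigroup_gen (Sally_gens e m n)).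

Lemma Sally_gensP i : (i \in Sally_gens e m n) =
  [&& e <= i, i <= 2 * e - 1, i != e + m & i != e + n].
Proof. by rewrite unfold_in !inE negb_or -andbA. Qed.

Lemma Sally_e : e \in Sally_gens e m n. Proof. by rewrite Sally_gensP; lia. Qed.

(** Below 3e, sums of three generators do not occur. *)
Lemma Sally_cases i : i \in S -> [\/ i = 0, i \in Sally_gens e m n,
  exists a b, [/\ a \in Sally_gens e m n, b \in Sally_gens e m n & i = a + b]
  | 3 * e <= i].
Proof.
move=> /asboolP[s sG ->].
have eG a : a \in Sally_gens e m n -> e <= a by rewrite Sally_gensP; lia.
case: s sG => [|a [|b [|c s]]] sG /=; first by constructor 1.
- by constructor 2; rewrite addn0 sG ?inE ?eqxx.
- constructor 3; exists a, b; rewrite addn0.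
  by split=> //; apply: sG; rewrite !inE eqxx ?orbT.
have := eG a (sG a _); have := eG b (sG b _); have := eG c (sG c _).
rewrite !inE !eqxx !orbT => /(_ isT) hc /(_ isT) hb /(_ isT) ha.
by constructor 4; lia.
Qed.

Lemma Sally_sum1 a : a < e -> a != m -> a != n -> e + a \in S.
Proof. by move=> *; apply: mem_semigroup_gen; rewrite Sally_gensP; lia. Qed.

Lemma Sally_sum2 a b : a < e -> b < e -> a != m -> b != m -> a != n -> b != n ->
  2 * e + (a + b) \in S.
Proof.
move=> *; have -> : 2 * e + (a + b) = (e + a) + (e + b) by lia.
by apply: semigroup_genD; apply: Sally_sum1.
Qed.

Lemma Sally_sum3 a b c : a < e -> b < e -> c < e ->
  a != m -> b != m -> c != m -> a != n -> b != n -> c != n ->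
  3 * e + (a + b + c) \in S.
Proof.
move=> *; have -> : 3 * e + (a + b + c) = (2 * e + (a + b)) + (e + c) by lia.
by apply: semigroup_genD; [apply: Sally_sum2 | apply: Sally_sum1].
Qed.

Lemma Sally_notin1 i : e + i < 2 * e -> i \in [:: m; n] -> e + i \notin S.
Proof.
move=> ie imn; apply/negP => /Sally_cases[|||].
- lia.
- by rewrite Sally_gensP; move: imn; rewrite !inE; lia.
- by move=> [a [b []]]; rewrite !Sally_gensP; lia.
lia.
Qed.

Lemma Sally_gap i : 0 < i < e -> i \notin S.
Proof.
move=> ie; apply/negP => /Sally_cases[|||].
- lia.
- by rewrite Sally_gensP; lia.
- by move=> [a [b []]]; rewrite !Sally_gensP; lia.
lia.
Qed.

Lemma Sally_notin2 k : k < e ->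
  (forall a b, a + b = k -> [|| a == m, a == n, b == m | b == n]) -> 2 * e + k \notin S.
Proof.
move=> ke kab; apply/negP => /Sally_cases[|||].
- lia.
- by rewrite Sally_gensP; lia.
- move=> [a [b []]]; rewrite !Sally_gensP => ha hb hab.
  by have := kab (a - e) (b - e); lia.
lia.
Qed.

(** The decomposition k = 0 + k is available unless k is m or n.  For m use
1 + (m-1).  For n use 1 + (n-1) or 2 + (n-2), which have no summand in common
because n >= 4, so that one of them avoids m. *)
Lemma Sally_2e k : k < e -> (k = m -> 2 <= m) -> (k = n -> 4 <= n) -> 2 * e + k \in S.
Proof.
move=> ke km kn.
have [kmE|km'] := eqVneq k m.
  have m2 := km kmE.
  have -> : k = 1 + (m - 1) by lia.
  by apply: Sally_sum2; lia.
have [knE|kn'] := eqVneq k n; last by rewrite -[k]add0n; apply: Sally_sum2; lia.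
have n4 := kn knE.
have [?|?] := boolP (n - 1 != m).
  have [m1'|m1'] := eqVneq m 1; last first.
    have -> : k = 1 + (n - 1) by lia.
    by apply: Sally_sum2; lia.
  have -> : k = 2 + (n - 2) by lia.
  by apply: Sally_sum2; lia.
have -> : k = 2 + (n - 2) by lia.
by apply: Sally_sum2; lia.
Qed.

Lemma Sally_positive i : 0 < i -> i \in S -> e <= i.
Proof.
by move=> i0; apply: contraLR; rewrite -ltnNge => ie; apply: Sally_gap; rewrite i0.
Qed.

(** Two gaps F1 and F2 such that S contains everything from F2 + e on are
pseudo-Frobenius numbers, since every positive element of S is at least e. *)
Lemma Sally_not_gorenstein (K : fieldType) L F1 F2 :
  (forall i, L <= i < L + e -> i \in S) ->
  F1 \notin S -> F2 \notin S -> F2 < F1 -> L <= F2 + e ->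
  ~ gorenstein (semigroup_ring K (Sally_gens e m n)).
Proof.
move=> LS F1S F2S F21 LF; have e0 : 0 < e by lia.
have LS' := semigroup_gen_interval e0 Sally_e LS.
apply: (gorenstein_pseudo_frobenius (e := e) (F1 := F1) (F2 := F2)) => //.
- exact: mem_semigroup_gen Sally_e.
- by exists L.
- by move=> i i0 /(Sally_positive i0) ei; apply: LS'; lia.
by move=> i i0 /(Sally_positive i0) ei; apply: LS'; lia.
Qed.

Lemma Sally_gorenstein_only (K : fieldType) :
  gorenstein (semigroup_ring K (Sally_gens e m n)) ->
  (m, n) = (2, 3) \/ (e, m, n) = (4, 1, 2).
Proof.
move=> gor; apply: contrapT => ne_mn; move: gor.
have [n4|n4] := leqP 4 n.
  have [m2|m2] := leqP 2 m.
    apply: (@Sally_not_gorenstein K (2 * e) (e + n) (e + m)); try lia.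
    - move=> i iL; have -> : i = 2 * e + (i - 2 * e) by lia.
      by apply: Sally_2e; lia.
    - by apply: Sally_notin1; [lia | rewrite !inE eqxx orbT].
    by apply: Sally_notin1; [lia | rewrite !inE eqxx].
  apply: (@Sally_not_gorenstein K (2 * e + 2) (2 * e + 1) (e + n)); try lia.
  - move=> i iL; have [?|?] := ltnP i (3 * e).
      have -> : i = 2 * e + (i - 2 * e) by lia.
      by apply: Sally_2e; lia.
    have [->|?] := eqVneq i (3 * e).
      by rewrite -[3 * e]addn0; apply: (@Sally_sum3 0 0 0); lia.
    have -> : i = 2 * e + ((e - 1) + 2) by lia.
    by apply: Sally_sum2; lia.
  - by apply: Sally_notin2; lia.
  by apply: Sally_notin1; [lia | rewrite !inE eqxx orbT].
have m1E : m = 1.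
  by apply: contrapT => m1'; apply: ne_mn; left; congr (_, _); lia.
have [n2|n3] := eqVneq n 2.
  have e5 : 5 <= e.
    rewrite leqNgt; apply/negP => e5; apply: ne_mn; right.
    by congr (_, _, _); lia.
  apply: (@Sally_not_gorenstein K (2 * e + 3) (2 * e + 2) (2 * e + 1)); try lia.
  - move=> i iL; have [?|?] := ltnP i (3 * e).
      have -> : i = 2 * e + (i - 2 * e) by lia.
      by apply: Sally_2e; lia.
    have [->|?] := eqVneq i (3 * e).
      by rewrite -[3 * e]addn0; apply: (@Sally_sum3 0 0 0); lia.
    have [->|?] := eqVneq i (3 * e + 1).
      have -> : 3 * e + 1 = 2 * e + ((e - 2) + 3) by lia.
      by apply: Sally_sum2; lia.
    have -> : i = 2 * e + ((e - 1) + 3) by lia.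
    by apply: Sally_sum2; lia.
  - by apply: Sally_notin2; lia.
  by apply: Sally_notin2; lia.
have {}n3 : n = 3 by lia.
apply: (@Sally_not_gorenstein K (2 * e + 4) (2 * e + 3) (2 * e + 1)); try lia.
- move=> i iL; have [?|?] := ltnP i (3 * e).
    have -> : i = 2 * e + (i - 2 * e) by lia.
    by apply: Sally_2e; lia.
  have [->|?] := eqVneq i (3 * e).
    by rewrite -[3 * e]addn0; apply: (@Sally_sum3 0 0 0); lia.
  have [->|?] := eqVneq i (3 * e + 1).
    have -> : 3 * e + 1 = 2 * e + ((e - 1) + 2) by lia.
    by apply: Sally_sum2; lia.
  have [->|?] := eqVneq i (3 * e + 2).
    by apply: (@Sally_sum3 2 0 0); lia.
  have -> : i = 2 * e + ((e - 1) + 4) by lia.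
  by apply: Sally_sum2; lia.
- by apply: Sally_notin2; lia.
by apply: Sally_notin2; lia.
Qed.

Lemma Sally_2_3_gorenstein (K : fieldType) : m = 2 -> n = 3 ->
  gorenstein (semigroup_ring K (Sally_gens e m n)).
Proof.
move=> m2 n3; have e0 : 0 < e by lia.
apply: (@gorenstein_symmetric K _ e (2 * e + 3)) => //.
- exact: mem_semigroup_gen Sally_e.
- by apply: Sally_notin2; lia.
- move=> i iF; apply: (semigroup_gen_interval (e := e) (L := 2 * e + 4)) => //; try lia.
    exact: Sally_e.
  move=> {iF}i iL; have [?|?] := ltnP i (3 * e).
    have -> : i = 2 * e + (i - 2 * e) by lia.
    by apply: Sally_2e; lia.
  have [->|?] := eqVneq i (3 * e).
    by rewrite -[3 * e]addn0; apply: (@Sally_sum3 0 0 0); lia.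
  have [->|?] := eqVneq i (3 * e + 1); first by apply: (@Sally_sum3 1 0 0); lia.
  have [->|?] := eqVneq i (3 * e + 2); first by apply: (@Sally_sum3 1 1 0); lia.
  have -> : i = 3 * e + 3 by lia.
  by apply: (@Sally_sum3 1 1 1); lia.
have small k : k <= 2 -> 2 * e + k \in S.
  move=> k2; have -> : k = (0 < k) + (1 < k) by lia.
  by apply: Sally_sum2; lia.
move=> i iF iS.
have [i0|i0] := posnP i; first by rewrite i0 semigroup_gen0 in iS.
have [ie|ie] := ltnP i e.
  have [i3|i3] := leqP i 3.
    have -> : 2 * e + 3 - i = 2 * e + (3 - i) by lia.
    by apply: small; lia.
  have -> : 2 * e + 3 - i = e + (e + 3 - i) by lia.
  by apply: Sally_sum1; lia.
have [i2e|i2e] := ltnP i (2 * e).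
  have [i2|i2] := eqVneq i (e + 2).
    have -> : 2 * e + 3 - i = e + 1 by lia.
    by apply: Sally_sum1; lia.
  have [i3|i3] := eqVneq i (e + 3).
    have -> : 2 * e + 3 - i = e + 0 by lia.
    by apply: Sally_sum1; lia.
  case/negP: iS; have -> : i = e + (i - e) by lia.
  by apply: Sally_sum1; lia.
have [->|i2] := eqVneq i (2 * e + 3); first by rewrite subnn semigroup_gen0.
case/negP: iS; have -> : i = 2 * e + (i - 2 * e) by lia.
by apply: small; lia.
Qed.

End Sally.

(** Symmetry of the semigroup generated by 4 and 7 is read off from a table. *)
Lemma Sally_4_1_2_gorenstein (K : fieldType) :
  gorenstein (semigroup_ring K (Sally_gens 4 1 2)).
Proof.
set S := semigroup_gen (Sally_gens 4 1 2).
have G4 : 4 \in Sally_gens 4 1 2 by rewrite Sally_gensP.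
have G7 : 7 \in Sally_gens 4 1 2 by rewrite Sally_gensP.
have S47 a b : 4 * a + 7 * b \in S.
  apply: semigroup_genD.
    elim: a => [|a IHa]; first exact: semigroup_gen0.
    by rewrite mulnS semigroup_genD // mem_semigroup_gen.
  elim: b => [|b IHb]; first exact: semigroup_gen0.
  by rewrite mulnS semigroup_genD // mem_semigroup_gen.
have S_47 i : i \in S -> exists a b, i = 4 * a + 7 * b.
  move=> /asboolP[s sG ->]; elim: s sG => [|c s IHs] sG; first by exists 0, 0.
  have [|a [b abE]] := IHs; first by move=> z zs; apply: sG; rewrite inE zs orbT.
  have := sG c (mem_head _ _); rewrite Sally_gensP => c47.
  have [cE|cE] := eqVneq c 4; [exists a.+1, b | exists a, b.+1]; rewrite /= abE; lia.
apply: (@gorenstein_symmetric K _ 4 17) => //.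
- exact: mem_semigroup_gen.
- by apply/negP => /S_47[a [b]]; lia.
- move=> i i17; apply: (semigroup_gen_interval (e := 4) (L := 18)) => // {i17} i iL.
  have [->|?] := eqVneq i 18; first exact: (S47 1 2).
  have [->|?] := eqVneq i 19; first exact: (S47 3 1).
  have [->|?] := eqVneq i 20; first exact: (S47 5 0).
  have -> : i = 21 by lia.
  exact: (S47 0 3).
have tab : all (fun i => has (fun a => has (fun b =>
    (i == 4 * a + 7 * b) || (17 - i == 4 * a + 7 * b)) (iota 0 3)) (iota 0 6))
  (iota 0 18) by [].
move=> i i17 iS; have /(allP tab)/hasP[a _ /hasP[b _]] : i \in iota 0 18.
  by rewrite mem_iota.
by case/orP => /eqP iE; [rewrite iE S47 in iS | rewrite iE S47].
Qed.

Local Open Scope ring_scope.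

Theorem theorem3p4 (K : closedFieldType) (charK0 : [pchar K] =i pred0)
    (e m n : nat) (m_ge1 : (1 <= m)%N) (lt_mn : (m < n)%N)
    (le_n : (n <= e - 2)%N) :
  gorenstein (semigroup_ring K (Sally_gens e m n)) <->
  (m, n) = (2%N, 3%N) \/ (e, m, n) = (4%N, 1%N, 2%N).
Proof.
split; first exact: Sally_gorenstein_only.
case=> [[m2 n3]|[-> -> ->]]; last exact: Sally_4_1_2_gorenstein.
exact: Sally_2_3_gorenstein.
Qed.
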